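(* Let $k$ be a non-spherically complete complete valuation field with non-trivial valuation, and let $G$ be a profinite group such that the set of open normal subgroups of $G$ is non-measurable. For any unitary Banach $k$-linear representation $(V,\rho)$ of $G$, $(V,\rho)$ is weakly irreducible if and only if the left $O_k[[G]]$-module $(V,\rho)^{\vee}$ is generically weakly simple.
   Context: A complete valuation field is a field $k$ complete with respect to a multiplicative ultrametric absolute value $|\cdot|$; $O_k=\{c\in k : |c|\le 1\}$. It is non-spherically complete if there is a sequence of closed balls in $k$ with the finite intersection property and empty intersection. A Banach $k$-vector space is a $k$-vector space complete with respect to an ultrametric norm with $\|cv\|=|c|\,\|v\|$. $V^{\vee}$ denotes the $O_k$-module (without topology) of $k$-linear maps $m\colon V\to k$ with $|m(v)|\le\|v\|$ for all $v$. The weak topology of $V$ is the weakest topology for which every $m\in V^{\vee}$ is continuous; weakly closed means closed in the weak topology. A set $I$ is non-measurable if it is not the case that $\#I\ge\aleph_1$ and $\#I$ carries a non-principal ultrafilter closed under countable intersections. $\mathrm{C}_0(I,k)$ is the Banach space, with supremum norm, of maps $f\colon I\to k$ such that $\{i : |f(i)|\ge\epsilon\}$ is finite for every $\epsilon>0$. A Banach $k$-vector space is free if it is isometrically $k$-linearly isomorphic to $\mathrm{C}_0(I,k)$ for some non-measurable set $I$. $O_k[[G]]=\varprojlim_H O_k[G/H]$ ($H$ running through the open normal subgroups). Its underlying $O_k$-module is identified with $\mathrm{C}(G,k)^{\vee}$, where $\mathrm{C}(G,k)$ is the Banach space of continuous functions $G\to k$ with supremum norm, through $\mu\mapsto(\sum_{\bar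 g\in G/H}\mu(1_{\bar g})[\bar g])_H$. A unitary Banach $k$-linear representation of $G$ is a pair $(V,\rho)$ of a free Banach $k$-vector space $V$ and a continuous map $\rho\colon G\times V\to V$ which is a $k$-linear group action of $G$ such that $v\mapsto\rho(g,v)$ is an isometry for every $g\in G$. $(V,\rho)^{\vee}$ denotes $V^{\vee}$ with the left $O_k[[G]]$-module structure $(\mu m)(v)=\mu\bigl(g\mapsto m(\rho(g^{-1},v))\bigr)$ for $\mu\in O_k[[G]]=\mathrm{C}(G,k)^{\vee}$, $m\in V^{\vee}$, $v\in V$; in particular $([g]m)(v)=m(\rho(g^{-1},v))$. A subrepresentation of $(V,\rho)$ is a $G$-stable $k$-linear subspace of $V$. $(V,\rho)$ is weakly irreducible if it admits precisely two weakly closed subrepresentations. For a torsion-free $O_k$-module $M$, identified with its image in $k\otimes_{O_k}M$, the gauge is the seminorm $\|m\|_M=\inf\{|c|^{-1} : c\in k^{\times},\ cm\in M\}$ on $k\otimes_{O_k}M$. $M$ is generically complete if it is torsion-free and $\|\cdot\|_M$ is a complete norm; then $kM$ denotes the Banach space $(k\otimes_{O_k}M,\|\cdot\|_M)$. An $O_k$-submodule $L\subset M$ is pure if $\{m\in M : \exists c\in O_k\setminus\{0\},\ cm\in L\}=L$; it is generically weakly closed in $M$ if $M$ is generically complete and $k\otimes_{O_k}L$ is weakly closed in the Banach space $kM$. A left $O_k[[G]]$-module is generically weakly simple if it admits precisely two left $O_k[[G]]$-submodules which are generically weakly closed and pure as $O_k$-submodules. *)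

(* Defs.v *)
From HB Require Import structures.
From mathcomp Require Import all_boot all_order all_algebra generic_quotient.
From mathcomp Require Import monoid.
From mathcomp Require Import all_classical all_reals.
From mathcomp Require Import topology.

Set Implicit Arguments.
Unset Strict Implicit.
Unset Printing Implicit Defensive.

Import Order.TTheory GRing.Theory Num.Theory.
Local Open Scope classical_set_scope.
Local Open Scope ring_scope.
Local Open Scope quotient_scope.

(* The library's normed structures assume |x *+ n| = |x| *+ n, which excludes
   ultrametric norms.  Norms are therefore plain functions W -> R here, and
   norm_space nrm is W with the metric topology of nrm. *)
Section NormSpace.
Variables (R : realType) (W : zmodType).

Definition norm_space (nrm : W -> R) : Type := W.

Definition complete_norm (nrm : W -> R) : Prop :=
  forall u : nat -> W,
    (forall e, 0 < e ->
       exists N, forall i j, (N <= i)%N -> (N <= j)%N -> nrm (u i - u j) < e) ->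
    exists l : W, forall e, 0 < e ->
      exists N, forall i, (N <= i)%N -> nrm (u i - l) < e.

Variable nrm : W -> R.

Definition norm_open : set_system W :=
  [set U | forall x, U x ->
     exists2 e : R, 0 < e & [set y | nrm (x - y) < e] `<=` U].

Let norm_openT : norm_open setT.
Proof. by move=> x _; exists 1. Qed.

Let norm_openI : setI_closed norm_open.
Proof.
move=> A B oA oB x [Ax Bx].
have [a a0 sA] := oA x Ax; have [b b0 sB] := oB x Bx.
exists (Num.min a b); first by rewrite lt_min a0 b0.
by move=> y /=; rewrite lt_min => /andP[ya yb]; split; [exact: sA|exact: sB].
Qed.

Let norm_open_bigU (I : Type) (f : I -> set W) :
  (forall i, norm_open (f i)) -> norm_open (\bigcup_i f i).
Proof.
move=> of_ x [i _ fix_]; have [e e0 sf] := of_ i x fix_.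
by exists e => // y ye; exists i => //; exact: sf.
Qed.

HB.instance Definition _ := Choice.on (norm_space nrm).
HB.instance Definition _ := isOpenTopological.Build (norm_space nrm)
  norm_openT norm_openI norm_open_bigU.

End NormSpace.

HB.mixin Record isValuationField (R : realType) K & GRing.Field K := {
  absv : K -> R;
  absv_ge0 : forall x, 0 <= absv x;
  absv_eq0 : forall x, absv x = 0 <-> x = 0;
  absvM : forall x y, absv (x * y) = absv x * absv y;
  absvD_max : forall x y, absv (x + y) <= Num.max (absv x) (absv y);
  absv_complete : complete_norm absv
}.

#[short(type="valuationFieldType")]
HB.structure Definition ValuationField (R : realType) :=
  {K of isValuationField R K & GRing.Field K}.

Definition nontrivial_valuation (R : realType) (K : valuationFieldType R) :=
  exists c : K, c != 0 /\ absv c != 1.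

Definition non_spherically_complete (R : realType) (K : valuationFieldType R) :=
  exists (c : nat -> K) (r : nat -> R),
    let B n := [set x : K | absv (x - c n) <= r n] in
    finI setT B /\ \bigcap_n B n = set0.

HB.mixin Record isProfiniteGroup G & Group G & Topological G := {
  mulg_continuous : continuous (fun p : G * G => (p.1 * p.2)%g);
  invg_continuous : continuous (fun g : G => g^-1%g);
  profinite_compact : compact [set: G];
  profinite_hausdorff : hausdorff_space G;
  profinite_totally_disconnected : totally_disconnected [set: G]
}.

#[short(type="profiniteGroupType")]
HB.structure Definition ProfiniteGroup :=
  {G of isProfiniteGroup G & Group G & Topological G}.

Definition open_normal_subgroup (G : profiniteGroupType) (H : set G) : Prop :=
  [/\ open H, H 1%g, forall x y, H x -> H y -> H (x * y^-1)%g &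
      forall x g, H x -> H (g * x * g^-1)%g].

(* With choice, #I >= aleph_1 amounts to I being uncountable. *)
Definition non_measurable (I : Type) : Prop :=
  ~ (~ countable [set: I] /\
     exists F : set_system I,
       [/\ UltraFilter F,
           forall i, F <> principal_filter i &
           forall A : nat -> set I, (forall n, F (A n)) -> F (\bigcap_n A n)]).

Definition ultranorm (R : realType) (K : valuationFieldType R) (W : lmodType K)
    (nrm : W -> R) : Prop :=
  [/\ forall v, 0 <= nrm v,
      forall v, nrm v = 0 -> v = 0,
      forall (c : K) v, nrm (c *: v) = absv c * nrm v &
      forall v w, nrm (v + w) <= Num.max (nrm v) (nrm w)].

HB.mixin Record isUltraNormed (R : realType) (K : valuationFieldType R) W
    & GRing.Lmodule K W := {
  bnorm : W -> R;
  bnormP : ultranorm bnorm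
}.

#[short(type="ultraNormedType")]
HB.structure Definition UltraNormed (R : realType) (K : valuationFieldType R) :=
  {W of isUltraNormed R K W & GRing.Lmodule K W}.

HB.mixin Record isBanach (R : realType) (K : valuationFieldType R) V
    & UltraNormed R K V := {
  bnorm_complete : complete_norm (bnorm : V -> R)
}.

#[short(type="banachType")]
HB.structure Definition Banach (R : realType) (K : valuationFieldType R) :=
  {V of isBanach R K V & UltraNormed R K V}.

(* sup is 0 on sets without a supremum; below, f is always bounded. *)
Definition supnorm (R : realType) (K : valuationFieldType R) (T : Type)
    (f : T -> K) : R := sup (range (fun t => absv (f t))).

Definition C0 (R : realType) (K : valuationFieldType R) (I : Type) :
    set (I -> K^o) :=
  [set f | forall e : R, 0 < e -> finite_set [set i | e <= absv (f i : K)]].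

Definition free_banach (R : realType) (K : valuationFieldType R)
    (V : banachType K) : Prop :=
  exists I : Type, non_measurable I /\
    exists phi : V -> (I -> K^o),
      [/\ linear phi, set_bij setT (@C0 R K I) phi &
          forall v, supnorm (phi v : I -> K) = bnorm v].

Section AbsvTheory.
Variables (R : realType) (K : valuationFieldType R).
Implicit Types x y : K.

Lemma absv0 : absv (0 : K) = 0.
Proof. exact/absv_eq0. Qed.

Lemma absv1 : absv (1 : K) = 1.
Proof.
have n0 : absv (1 : K) != 0.
  by apply/eqP => /absv_eq0/eqP; rewrite oner_eq0.
by apply: (mulfI n0); rewrite -absvM !mulr1.
Qed.

Lemma absvN1 : absv (-1 : K) = 1.
Proof.
have : absv (-1 : K) ^+ 2 = 1 by rewrite expr2 -absvM mulrNN mulr1 absv1.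
by move/eqP; rewrite sqrf_eq1 => /orP[/eqP //|/eqP h];
  have := absv_ge0 (-1 : K); rewrite h ler0N1.
Qed.

Lemma absvN x : absv (- x) = absv x.
Proof. by rewrite -mulN1r absvM absvN1 mul1r. Qed.

Lemma absvB_max x y : absv (x - y) <= Num.max (absv x) (absv y).
Proof. by rewrite -(absvN y) absvD_max. Qed.

Lemma absv_distC x y : absv (x - y) = absv (y - x).
Proof. by rewrite -absvN opprB. Qed.

Lemma absv_gt0 x : x != 0 -> 0 < absv x.
Proof.
by move=> x0; rewrite lt_neqAle absv_ge0 andbT eq_sym;
  apply: contra_neq x0 => /absv_eq0.
Qed.

Lemma absvV x : absv x^-1 = (absv x)^-1.
Proof.
have [->|x0] := eqVneq x 0; first by rewrite invr0 absv0 invr0.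
have n0 := lt0r_neq0 (absv_gt0 x0).
by apply: (mulfI n0); rewrite -absvM !divff ?absv1.
Qed.

Lemma norm_space_absvP (x : K) (A : set K) :
  nbhs (x : norm_space (absv : K -> R)) A <->
  exists2 e : R, 0 < e & [set y | absv (x - y) < e] `<=` A.
Proof.
rewrite nbhsE; split.
  move=> [U [oU Ux] UA]; have [e e0 sU] := oU x Ux.
  by exists e => //; exact: subset_trans UA.
move=> [e e0 sA]; exists [set y | absv (x - y) < e] => //.
split; last by rewrite /= subrr absv0.
move=> y /= xy; exists e => // z /= yz.
rewrite -(subrKA y) (le_lt_trans (absvD_max _ _))//.
by rewrite gt_max xy yz.
Qed.

End AbsvTheory.

Section ValuationRing.
Variables (R : realType) (K : valuationFieldType R).

Definition valring_pred : {pred K} := [pred x | absv x <= 1].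

Record valring : Type := Valring
  { valring_val :> K; valringP : valring_val \in valring_pred }.

HB.instance Definition _ := [isSub for valring_val].
HB.instance Definition _ := [Choice of valring by <:].

Let valring_closed : subring_closed valring_pred.
Proof.
split; first by rewrite inE absv1.
  move=> x y; rewrite !inE => hx hy.
  by rewrite (le_trans (absvB_max _ _))// ge_max hx hy.
move=> x y; rewrite !inE => hx hy.
by rewrite absvM mulr_ile1// absv_ge0.
Qed.

HB.instance Definition _ := GRing.isSubringClosed.Build K valring_pred
  valring_closed.
HB.instance Definition _ := [SubChoice_isSubComNzRing of valring by <:].

End ValuationRing.
Arguments valring {R} K.

Section WeakTopology.
Variables (R : realType) (K : valuationFieldType R).
Variables (W : lmodType K) (nrm : W -> R).

Definition dual_ball : set (W -> K) :=
  [set m | scalar m /\ forall v, absv (m v) <= nrm v].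

Definition weak_space : Type :=
  sup_topology (fun m : {m : W -> K | dual_ball m} =>
    Topological.on
      (initial_topology (sval m : W -> norm_space (absv : K -> R)))).

HB.instance Definition _ := Topological.on weak_space.

Definition weakly_closed (A : set W) : Prop := closed (A : set weak_space).

End WeakTopology.

Section Dual.
Variables (R : realType) (K : valuationFieldType R) (W : ultraNormedType K).

Definition dual_pred : {pred W -> K} := [pred m | `[< dual_ball (bnorm : W -> R) m >]].

Record dual : Type := Dual
  { dual_val :> W -> K; dualP : dual_val \in dual_pred }.

HB.instance Definition _ := [isSub for dual_val].
HB.instance Definition _ := [Choice of dual by <:].

Lemma dual_predP (m : W -> K) :
  reflect (dual_ball (bnorm : W -> R) m) (m \in dual_pred).
Proof. exact: asboolP. Qed.

Let dual_closed : zmod_closed dual_pred.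
Proof.
split.
  apply/dual_predP; split; first by move=> a u v /=; rewrite mulr0 addr0.
  by move=> v; rewrite absv0; have [+ _ _ _] := bnormP (s := W); apply.
move=> f g /dual_predP[fl fb] /dual_predP[gl gb]; apply/dual_predP; split.
  move=> a u v; rewrite !fctE fl gl /= mulrBr opprD !addrA; congr (_ + _).
  by rewrite -!addrA; congr (_ + _); rewrite addrC.
by move=> v; rewrite (le_trans (absvB_max _ _))// ge_max fb gb.
Qed.

HB.instance Definition _ := GRing.isZmodClosed.Build (W -> K) dual_pred
  dual_closed.
HB.instance Definition _ := [SubChoice_isSubZmodule of dual by <:].

Lemma dual_scalar (m : dual) : scalar m.
Proof. by have /dual_predP[] := dualP m. Qed.

Lemma dual_le (m : dual) v : absv (m v) <= bnorm v.
Proof. by have /dual_predP[_] := dualP m. Qed.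

Lemma dual_ext (m n : dual) : m =1 n -> m = n.
Proof. by move=> mn; apply/val_inj/funext. Qed.

Lemma dualD (m : dual) v w : m (v + w) = m v + m w.
Proof. by have := dual_scalar m 1 v w; rewrite scale1r mul1r. Qed.

Lemma dual0 (m : dual) : m 0 = 0.
Proof. by apply: (addrI (m 0)); rewrite -dualD !addr0. Qed.

Lemma dualZ (m : dual) c v : m (c *: v) = c * m v.
Proof. by have := dual_scalar m c v 0; rewrite !addr0 dual0 addr0. Qed.

Lemma dualB (m : dual) v w : m (v - w) = m v - m w.
Proof. by rewrite dualD -scaleN1r dualZ mulN1r. Qed.

End Dual.

Section ContinuousFunctions.
Variables (R : realType) (G : profiniteGroupType) (K : valuationFieldType R).

Definition cfun_pred : {pred G -> K^o} :=
  [pred f | `[< continuous (f : G -> norm_space (absv : K -> R)) >]].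

Record cfun : Type := CFun
  { cfun_val :> G -> K^o; cfunP : cfun_val \in cfun_pred }.

HB.instance Definition _ := [isSub for cfun_val].
HB.instance Definition _ := [Choice of cfun by <:].

Lemma cfun_predP (f : G -> K) :
  reflect (forall g (e : R), 0 < e -> \forall h \near g, absv (f g - f h) < e)
          (f \in cfun_pred).
Proof.
apply: (iffP (asboolP _)) => cf g; last first.
  move=> A /norm_space_absvP[e e0 sA]; rewrite /nbhs /=.
  by apply: filterS (cf g e e0) => h; exact: sA.
move=> e e0; apply: (cf g [set y | absv (f g - y : K) < e]).
by apply/norm_space_absvP; exists e.
Qed.

Let cfun_closed : submod_closed cfun_pred.
Proof.
split.
  by apply/cfun_predP => g e e0; apply: nearW => h; rewrite subrr absv0.
move=> a f1 f2 /cfun_predP c1 /cfun_predP c2; apply/cfun_predP => g e e0.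
have [->|a0] := eqVneq a 0.
  have {}c2 := c2 g e e0; apply: filterS c2 => h.
  by rewrite !fctE /= !scale0r !add0r.
have a1 : 0 < absv (a : K) by exact: absv_gt0.
have e1 : 0 < e / absv (a : K) by rewrite divr_gt0.
apply: filterS2 (c1 g _ e1) (c2 g _ e0) => h h1 h2.
rewrite !fctE opprD addrACA (le_lt_trans (absvD_max _ _))// gt_max h2 andbT.
rewrite -[X in absv X](scalerBr (a : K) (f1 g : K^o)).
by rewrite absvM mulrC -ltr_pdivlMr.
Qed.

HB.instance Definition _ := GRing.isSubmodClosed.Build K (G -> K^o) cfun_pred
  cfun_closed.
HB.instance Definition _ := [SubChoice_isSubLmodule of cfun by <:].

Lemma cfun_bounded (f : cfun) : exists M, forall g, absv (f g : K) <= M.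
Proof.
have /cfun_predP cf := cfunP f.
have /compact_near_coveringP ncov := @profinite_compact G.
have := ncov nat \oo (fun n g => absv (f g : K) <= n%:R) _.
case.
  move=> g _; have [N _ hN] := @nbhs_infty_gt (Num.truncn (absv (f g : K))).+1.
  exists ([set h | absv (f g - f h : K) < 1], [set n | (N <= n)%N]).
    by split; [exact: cf | exists N].
  move=> [h n] /= [h1 Nn].
  rewrite -[f h](subKr (f g)) (le_trans (absvB_max _ _))// ge_max.
  have gn : absv (f g : K) < n%:R.
    rewrite (lt_le_trans (truncnS_gt _))// ler_nat ltnW//.
    exact: hN.
  by rewrite (ltW gn)/= (le_trans (ltW h1))// ler1n (leq_trans _ (hN n Nn)).
by move=> N _ hN; exists N%:R => g; apply: (hN N) => /=.
Qed.

Lemma cfun_has_sup (f : cfun) : has_sup (range (fun g => absv (f g : K))).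
Proof.
split; first by exists (absv (f 1%g : K)), 1%g.
by have [M hM] := cfun_bounded f; exists M => _ [g _ <-]; exact: hM.
Qed.

Lemma supnorm_ge (f : cfun) g : absv (f g : K) <= supnorm (f : G -> K).
Proof. by apply: ub_le_sup; [case: (cfun_has_sup f)|exists g]. Qed.

Lemma supnorm_le (f : cfun) (M : R) :
  (forall g, absv (f g : K) <= M) -> supnorm (f : G -> K) <= M.
Proof.
move=> fM; apply: ge_sup; first by case: (cfun_has_sup f).
by move=> _ [g _ <-].
Qed.

Let supnormP : ultranorm (fun f : cfun => supnorm (f : G -> K)).
Proof.
have ge0 (f : cfun) : 0 <= supnorm (f : G -> K).
  exact: le_trans (absv_ge0 _) (supnorm_ge f 1%g).
split => //.
- move=> f f0; apply/val_inj/funext => g.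
  by apply/absv_eq0/le_anti; rewrite absv_ge0 -f0 supnorm_ge.
- have Zle (c : K) (f : cfun) :
      supnorm (c *: f : G -> K) <= absv c * supnorm (f : G -> K).
    apply: supnorm_le => g.
    by rewrite absvM ler_wpM2l// ?absv_ge0// supnorm_ge.
  move=> c f; apply/le_anti; rewrite Zle andTb.
  have [c0|c0] := eqVneq c (0 : K); first by rewrite c0 absv0 mul0r ge0.
  rewrite -ler_pdivlMl ?absv_gt0// -absvV.
  by apply: le_trans (Zle _ _); rewrite scalerA mulVf// scale1r.
- move=> f1 f2; apply: supnorm_le => g.
  rewrite (le_trans (absvD_max _ _))// ge_max !le_max !supnorm_ge/=.
  by rewrite orbT.
Qed.

HB.instance Definition _ := isUltraNormed.Build R K cfun supnormP.

End ContinuousFunctions.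

Section Iwasawa.
Variables (R : realType) (G : profiniteGroupType) (K : valuationFieldType R).
Local Notation cfun := (cfun G K).
Implicit Types (f : cfun) (g h : G).

(* O_k[[G]], carried by C(G,k)^vee: the measure mu stands for the compatible
   family of the elements \sum_(gH) mu(1_(gH)) [gH] of the group rings
   O_k[G/H].  The group element [g] is evaluation at g, and the product induced
   by the group rings is the convolution
   (mu * nu)(f) = mu(g |-> nu(h |-> f(g h))). *)
Definition iwasawa : Type := dual cfun.

HB.instance Definition _ := GRing.Zmodule.on iwasawa.

Let translate_subproof f g : (fun h => f (g * h)%g) \in @cfun_pred R G K.
Proof.
apply/cfun_predP => h e e0.
have /cfun_predP cf := cfunP f.
have cl : {for h, continuous (fun h : G => (g * h)%g)}.
  apply: (@continuous_comp _ _ _ (fun h : G => (g, h))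
    (fun p : G * G => (p.1 * p.2)%g)); last exact: mulg_continuous.
  by apply: cvg_pair; [exact: cvg_cst|exact: cvg_id].
by apply: (cl _ (cf (g * h)%g e e0)).
Qed.

Definition translate f g : cfun := CFun (translate_subproof f g).

Let partial_subproof (nu : iwasawa) f :
  (fun g => nu (translate f g)) \in @cfun_pred R G K.
Proof.
apply/cfun_predP => g e e0.
have e20 : 0 < e / 2 by rewrite divr_gt0.
have /cfun_predP cf := cfunP f.
have /compact_near_coveringP ncov := @profinite_compact G.
have := ncov G (nbhs g)
  (fun g' h => absv (f (g * h)%g - f (g' * h)%g : K) < e / 2) _ _.
have cov : \forall g' \near g, [set: G] `<=`
    (fun h => absv (f (g * h)%g - f (g' * h)%g : K) < e / 2).
  apply: ncov => h _.
  have cl := @mulg_continuous G (g, h) _ (cf (g * h)%g _ e20).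
  case: cl => -[A B] /= [nA nB] AB.
  exists (B, A) => //= -[h' g'] /= [Bh' Ag'].
  rewrite -(subrKA (f (g * h)%g)) (le_lt_trans (absvD_max _ _))// gt_max.
  apply/andP; split; last by apply: (AB (g', h')).
  by rewrite absv_distC; apply: (AB (g, h')); split => //=; exact: nbhs_singleton.
move=> _; apply: filterS cov => g' hg'.
rewrite -dualB (le_lt_trans (dual_le _ _))//.
apply: (@le_lt_trans _ _ (e / 2)); last by rewrite ltr_pdivrMr// ltr_pMr// ltr1n.
by apply: supnorm_le => h; apply/ltW/hg'.
Qed.

Definition partial_integral (nu : iwasawa) f : cfun :=
  CFun (partial_subproof nu f).

Let mul_subproof (mu nu : iwasawa) :
  (fun f => mu (partial_integral nu f)) \in @dual_pred R K cfun.
Proof.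
apply/dual_predP; split.
  move=> a f1 f2.
  rewrite -dualZ -dualD; congr (mu _); apply/val_inj/funext => g /=.
  rewrite -[RHS]/(a * _ + _) -dualZ -dualD; congr (nu _).
  exact/val_inj/funext.
move=> f; rewrite (le_trans (dual_le _ _))//; apply: supnorm_le => g.
rewrite (le_trans (dual_le _ _))//; apply: supnorm_le => h.
exact: (supnorm_ge f (g * h)%g).
Qed.

Definition iwasawa_mul (mu nu : iwasawa) : iwasawa := Dual (mul_subproof mu nu).

Let group_element_subproof g :
  (fun f => f g : K) \in @dual_pred R K cfun.
Proof. by apply/dual_predP; split => // f; exact: supnorm_ge. Qed.

Definition group_element g : iwasawa := Dual (group_element_subproof g).

Let iwasawa_mulA : associative iwasawa_mul.
Proof.
move=> a b c; apply: dual_ext => f /=; congr (a _).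
apply/val_inj/funext => g /=; congr (b _).
apply/val_inj/funext => h /=; congr (c _).
by apply/val_inj/funext => x /=; rewrite mulgA.
Qed.

Let iwasawa_mul1x : left_id (group_element 1%g) iwasawa_mul.
Proof.
move=> a; apply: dual_ext => f /=; congr (a _).
by apply/val_inj/funext => g /=; rewrite mul1g.
Qed.

Let iwasawa_mulx1 : right_id (group_element 1%g) iwasawa_mul.
Proof.
move=> a; apply: dual_ext => f /=; congr (a _).
by apply/val_inj/funext => g /=; rewrite mulg1.
Qed.

Let iwasawa_mulDl : left_distributive iwasawa_mul +%R.
Proof. by move=> a b c; exact: dual_ext. Qed.

Let iwasawa_mulDr : right_distributive iwasawa_mul +%R.
Proof.
move=> a b c; apply: dual_ext => f /=; rewrite -[RHS]/(a _ + a _) -dualD.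
by congr (a _); exact/val_inj/funext.
Qed.

HB.instance Definition _ := GRing.Zmodule_isPzRing.Build iwasawa
  iwasawa_mulA iwasawa_mul1x iwasawa_mulx1 iwasawa_mulDl iwasawa_mulDr.

Let iwasawa_const_subproof (c : valring K) :
  (fun f => val c * f 1%g : K) \in @dual_pred R K cfun.
Proof.
apply/dual_predP; split.
  by move=> a f1 f2; rewrite /= [LHS]mulrDr !mulrA [val c * a]mulrC.
move=> f; have := valringP c; rewrite inE => c1.
by rewrite absvM (le_trans _ (supnorm_ge f 1%g))// ler_piMl// absv_ge0.
Qed.

(* The scalar c of O_k, i.e. c [1]. *)
Definition iwasawa_const (c : valring K) : iwasawa :=
  Dual (iwasawa_const_subproof c).

Lemma group_elementM g h :
  group_element g * group_element h = group_element (g * h)%g.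
Proof. exact: dual_ext. Qed.

Lemma iwasawa_const1 : iwasawa_const 1 = 1.
Proof. by apply: dual_ext => f /=; rewrite mul1r. Qed.

Lemma iwasawa_constD c d :
  iwasawa_const (c + d) = iwasawa_const c + iwasawa_const d.
Proof. by apply: dual_ext => f /=; exact: mulrDl. Qed.

Lemma iwasawa_constM c d :
  iwasawa_const (c * d) = iwasawa_const c * iwasawa_const d.
Proof. by apply: dual_ext => f /=; rewrite mulg1 mulrA. Qed.

End Iwasawa.

(* An O_k[[G]]-module seen as an O_k-module. *)
Section Restriction.
Variables (R : realType) (G : profiniteGroupType) (K : valuationFieldType R).
Variable M : lmodType (iwasawa G K).

Definition restricted : Type := M.

HB.instance Definition _ := GRing.Zmodule.on restricted.

Let rscale (c : valring K) (m : restricted) : restricted :=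
  iwasawa_const G c *: (m : M).

Let rscaleA a b v : rscale a (rscale b v) = rscale (a * b) v.
Proof. by rewrite /rscale scalerA iwasawa_constM. Qed.

Let rscale1 : left_id 1 rscale.
Proof. by move=> v; rewrite /rscale iwasawa_const1 scale1r. Qed.

Let rscaleDr : right_distributive rscale +%R.
Proof. by move=> a u v; exact: scalerDr. Qed.

Let rscaleDl v : {morph rscale^~ v : a b / a + b}.
Proof. by move=> a b; rewrite /rscale iwasawa_constD scalerDl. Qed.

HB.instance Definition _ := GRing.Zmodule_isLmodule.Build (valring K) restricted
  rscaleA rscale1 rscaleDr rscaleDl.

End Restriction.

Section Representations.
Variables (R : realType) (G : profiniteGroupType) (K : valuationFieldType R).

Record unitary_rep : Type := UnitaryRep {
  rep_space : banachType K;
  rep_act : G -> rep_space -> rep_space;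
  rep_free : free_banach rep_space;
  rep_continuous :
    continuous ((fun p => rep_act p.1 p.2) :
      G * norm_space (bnorm : rep_space -> R) ->
      norm_space (bnorm : rep_space -> R));
  rep_linear : forall g, linear (rep_act g);
  rep_act1 : forall v, rep_act 1%g v = v;
  rep_actM : forall g h v, rep_act (g * h)%g v = rep_act g (rep_act h v);
  rep_isometry : forall g v, bnorm (rep_act g v) = bnorm v
}.

Variable r : unitary_rep.
Local Notation V := (rep_space r).

Definition subrepresentation (W : set V) : Prop :=
  submod_closed (mem W) /\ forall g v, W v -> W (rep_act g v).

Definition weakly_irreducible : Prop :=
  ([set W | subrepresentation W /\ weakly_closed (bnorm : V -> R) W]
     #= `I_2)%card.

Definition rep_dual : Type := dual V.

HB.instance Definition _ := GRing.Zmodule.on rep_dual.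

Let orbit_subproof (m : rep_dual) (v : V) :
  (fun g => m (rep_act g^-1%g v)) \in @cfun_pred R G K.
Proof.
apply/cfun_predP => g e e0.
have [_ _ nZ nD] := bnormP (s := V).
have B : nbhs (rep_act g^-1%g v : norm_space (bnorm : V -> R))
    [set w | bnorm (rep_act g^-1%g v - w) < e].
  rewrite nbhsE; exists [set w | bnorm (rep_act g^-1%g v - w) < e] => //.
  split; last first.
    by rewrite /= subrr -(scale0r (0 : V)) nZ absv0 mul0r.
  move=> x /= x1; exists e => // z /= z1.
  by rewrite -(subrKA x) (le_lt_trans (nD _ _))// gt_max x1 z1.
have c : {for g, continuous ((fun g => (g^-1%g, v)) :
    G -> G * norm_space (bnorm : V -> R))}.
  by apply: (@cvg_pair _ _ _ _ (nbhs (g^-1%g)) (nbhs (v : norm_space (bnorm : V -> R))));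
    [exact: invg_continuous|exact: cvg_cst].
have n : \forall h \near g, bnorm (rep_act g^-1%g v - rep_act h^-1%g v) < e.
  exact: c _ (@rep_continuous r (g^-1%g, v) _ B).
apply: filterS n => h /= hh.
by rewrite -dualB (le_lt_trans (dual_le _ _)).
Qed.

Definition orbit_fun (m : rep_dual) (v : V) : cfun G K :=
  CFun (orbit_subproof m v).

Let dual_act_subproof (mu : iwasawa G K) (m : rep_dual) :
  (fun v => mu (orbit_fun m v)) \in @dual_pred R K V.
Proof.
apply/dual_predP; split.
  move=> a u v; rewrite -dualZ -dualD; congr (mu _).
  by apply/val_inj/funext => g /=; rewrite rep_linear dualD dualZ.
move=> v; rewrite (le_trans (dual_le _ _))//; apply: supnorm_le => g.
by rewrite (le_trans (dual_le _ _))// rep_isometry.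
Qed.

Definition dual_act (mu : iwasawa G K) (m : rep_dual) : rep_dual :=
  Dual (dual_act_subproof mu m).

Let dual_actA mu nu m : dual_act mu (dual_act nu m) = dual_act (mu * nu) m.
Proof.
apply: dual_ext => v /=; congr (mu _); apply/val_inj/funext => g /=.
congr (nu _); apply/val_inj/funext => h /=.
by rewrite invgM rep_actM.
Qed.

Let dual_act1 : left_id 1 dual_act.
Proof. by move=> m; apply: dual_ext => v /=; rewrite invg1 rep_act1. Qed.

Let dual_actDr : right_distributive dual_act +%R.
Proof.
move=> mu m n; apply: dual_ext => v /=.
rewrite -[RHS]/(mu _ + mu _) -dualD; congr (mu _).
exact/val_inj/funext.
Qed.

Let dual_actDl m : {morph dual_act^~ m : mu nu / mu + nu}.
Proof. by move=> mu nu; exact: dual_ext. Qed.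

HB.instance Definition _ := GRing.Zmodule_isLmodule.Build (iwasawa G K) rep_dual
  dual_actA dual_act1 dual_actDr dual_actDl.

Lemma group_element_actE g (m : rep_dual) v :
  (group_element K g *: m : rep_dual) v = m (rep_act g^-1%g v).
Proof. by []. Qed.

Lemma restricted_scaleE (c : valring K) (m : restricted rep_dual) v :
  (c *: m : rep_dual) v = val c * (m : rep_dual) v.
Proof. by rewrite /= invg1 rep_act1. Qed.

End Representations.

(* k (x)_(O_k) M, as formal sums of pairs (c, m) modulo the relation that every
   O_k-balanced biadditive map identifies them. *)
Section Tensor.
Variables (R : realType) (K : valuationFieldType R) (M : lmodType (valring K)).

Definition balanced (A : zmodType) (b : K -> M -> A) : Prop :=
  [/\ forall c d m, b (c + d) m = b c m + b d m,
      forall c m n, b c (m + n) = b c m + b c n &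
      forall c (a : valring K) m, b (c * val a) m = b c (a *: m)].

Definition tensor_rel (s t : seq (K * M)) : bool :=
  `[< forall (A : zmodType) (b : K -> M -> A), balanced b ->
        \sum_(p <- s) b p.1 p.2 = \sum_(p <- t) b p.1 p.2 >].

Let tensor_rel_refl : reflexive tensor_rel.
Proof. by move=> s; apply/asboolP. Qed.

Let tensor_rel_sym : symmetric tensor_rel.
Proof.
by move=> s t; apply/asboolP/asboolP => st A b bb; rewrite st.
Qed.

Let tensor_rel_trans : transitive tensor_rel.
Proof.
move=> t s u /asboolP st /asboolP tu; apply/asboolP => A b bb.
by rewrite st// tu.
Qed.

Canonical tensor_equiv :=
  EquivRel tensor_rel tensor_rel_refl tensor_rel_sym tensor_rel_trans.

Definition tensor : Type := {eq_quot tensor_equiv}.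

HB.instance Definition _ := Choice.on tensor.

Definition sum_tensor (s : seq (K * M)) : tensor := \pi_{eq_quot tensor_equiv} s.

Definition pure_tensor (c : K) (m : M) : tensor := sum_tensor [:: (c, m)].

Definition tensor_eval (A : zmodType) (b : K -> M -> A) (w : tensor) : A :=
  \sum_(p <- repr (w : {eq_quot tensor_equiv})) b p.1 p.2.

Lemma sum_tensorP s t : sum_tensor s = sum_tensor t <->
  forall (A : zmodType) (b : K -> M -> A), balanced b ->
    \sum_(p <- s) b p.1 p.2 = \sum_(p <- t) b p.1 p.2.
Proof.
split; first by move=> /eqmodP/asboolP.
by move=> st; apply/eqmodP/asboolP.
Qed.

Lemma tensor_eval_sum (A : zmodType) (b : K -> M -> A) s : balanced b ->
  tensor_eval b (sum_tensor s) = \sum_(p <- s) b p.1 p.2.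
Proof.
move=> bb; apply: (iffLR (sum_tensorP _ _)) => //.
by rewrite /sum_tensor reprK.
Qed.

Lemma tensor_repr (w : tensor) : exists s, w = sum_tensor s.
Proof. by exists (repr (w : {eq_quot tensor_equiv})); rewrite /sum_tensor reprK. Qed.

Lemma tensorP (w x : tensor) :
  (forall (A : zmodType) (b : K -> M -> A), balanced b ->
     tensor_eval b w = tensor_eval b x) -> w = x.
Proof.
have [s ->] := tensor_repr w; have [t ->] := tensor_repr x => st.
by apply/sum_tensorP => A b bb; rewrite -!tensor_eval_sum// st.
Qed.

Definition tensor_add (w x : tensor) : tensor :=
  sum_tensor (repr (w : {eq_quot tensor_equiv}) ++
              repr (x : {eq_quot tensor_equiv})).
Definition tensor_scale (a : K) (w : tensor) : tensor :=
  sum_tensor [seq (a * p.1, p.2) | p <- repr (w : {eq_quot tensor_equiv})].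
Definition tensor_opp := tensor_scale (-1).

Section Eval.
Variables (A : zmodType) (b : K -> M -> A).

Lemma balanced_scale a : balanced b -> balanced (fun c m => b (a * c) m).
Proof.
case=> b1 b2 b3; split => [c d m|c m n|c x m].
- by rewrite mulrDr b1.
- by rewrite b2.
- by rewrite mulrA b3.
Qed.

Lemma tensor_eval0 : balanced b -> tensor_eval b (sum_tensor [::]) = 0.
Proof. by move=> bb; rewrite tensor_eval_sum// big_nil. Qed.

Lemma tensor_evalD w x : balanced b ->
  tensor_eval b (tensor_add w x) = tensor_eval b w + tensor_eval b x.
Proof. by move=> bb; rewrite tensor_eval_sum// big_cat. Qed.

Lemma tensor_evalZ a w : balanced b ->
  tensor_eval b (tensor_scale a w) = tensor_eval (fun c m => b (a * c) m) w.
Proof. by move=> bb; rewrite tensor_eval_sum// big_map. Qed.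

Lemma tensor_evalDl a c w : balanced b -> tensor_eval b (tensor_scale (a + c) w) =
  tensor_eval b (tensor_scale a w) + tensor_eval b (tensor_scale c w).
Proof.
move=> bb; rewrite !tensor_evalZ// /tensor_eval -big_split.
by apply: eq_bigr => p _ /=; case: bb => b1 _ _; rewrite mulrDl b1.
Qed.

Lemma tensor_eval_scale0 w : balanced b -> tensor_eval b (tensor_scale 0 w) = 0.
Proof.
move=> bb; apply: (addrI (tensor_eval b (tensor_scale 0 w))).
by rewrite -tensor_evalDl// !addr0.
Qed.

Lemma tensor_eval_scale1 w :
  balanced b -> tensor_eval b (tensor_scale 1 w) = tensor_eval b w.
Proof.
by move=> bb; rewrite tensor_evalZ//; apply: eq_bigr => p _; rewrite mul1r.
Qed.

End Eval.

Let tensor_addA : associative tensor_add.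
Proof.
by move=> u v w; apply: tensorP => A b bb; rewrite !tensor_evalD// addrA.
Qed.

Let tensor_addC : commutative tensor_add.
Proof. by move=> u v; apply: tensorP => A b bb; rewrite !tensor_evalD// addrC. Qed.

Let tensor_add0 : left_id (sum_tensor [::]) tensor_add.
Proof.
by move=> u; apply: tensorP => A b bb; rewrite tensor_evalD// tensor_eval0// add0r.
Qed.

Let tensor_addN : left_inverse (sum_tensor [::]) (tensor_scale (-1)) tensor_add.
Proof.
move=> u; apply: tensorP => A b bb; rewrite tensor_evalD// tensor_eval0//.
by rewrite -[X in _ + X]tensor_eval_scale1// -tensor_evalDl// addNr tensor_eval_scale0.
Qed.

HB.instance Definition _ := GRing.isZmodule.Build tensor
  tensor_addA tensor_addC tensor_add0 tensor_addN.

Let tensor_scaleA a c w : tensor_scale a (tensor_scale c w) = tensor_scale (a * c) w.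
Proof.
apply: tensorP => A b bb; rewrite !tensor_evalZ//; last exact: balanced_scale.
by apply: eq_bigr => p _; rewrite mulrA.
Qed.

Let tensor_scale1 : left_id 1 tensor_scale.
Proof. by move=> w; apply: tensorP => A b bb; rewrite tensor_eval_scale1. Qed.

Let tensor_scaleDr : right_distributive tensor_scale +%R.
Proof.
move=> a w x; apply: tensorP => A b bb.
rewrite tensor_evalZ// !tensor_evalD//; last exact: balanced_scale.
by rewrite !tensor_evalZ.
Qed.

Let tensor_scaleDl w : {morph tensor_scale^~ w : a c / a + c}.
Proof.
by move=> a c; apply: tensorP => A b bb; rewrite tensor_evalD// tensor_evalDl.
Qed.

HB.instance Definition _ := GRing.Zmodule_isLmodule.Build K tensor
  tensor_scaleA tensor_scale1 tensor_scaleDr tensor_scaleDl.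

Lemma pure_tensorZ a c m : a *: pure_tensor c m = pure_tensor (a * c) m.
Proof.
rewrite -[LHS]/(tensor_scale a _); apply: tensorP => A b bb.
rewrite tensor_evalZ// !tensor_eval_sum ?big_seq1//; exact: balanced_scale.
Qed.

Lemma pure_tensor_balanced : balanced pure_tensor.
Proof.
split.
- move=> c d m; rewrite -[RHS]/(tensor_add _ _); apply: tensorP => A b bb.
  by rewrite tensor_evalD// !tensor_eval_sum// !big_seq1; case: bb => ->.
- move=> c m n; rewrite -[RHS]/(tensor_add _ _); apply: tensorP => A b bb.
  by rewrite tensor_evalD// !tensor_eval_sum// !big_seq1; case: bb => _ ->.
- by move=> c a m; apply/sum_tensorP => A b [_ _ h]; rewrite !big_seq1 h.
Qed.

End Tensor.

Section GenericNotions.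
Variables (R : realType) (K : valuationFieldType R) (M : lmodType (valring K)).

Definition torsion_free : Prop :=
  forall (c : valring K) (m : M), c != 0 -> c *: m = 0 -> m = 0.

Definition gauge (w : tensor M) : R :=
  inf [set (absv c)^-1 | c in
    [set c : K | c != 0 /\ exists m : M, c *: w = pure_tensor 1 m]].

Definition generically_complete : Prop :=
  [/\ torsion_free, ultranorm gauge & complete_norm gauge].

Definition pure_submodule (L : set M) : Prop :=
  [set m | exists c : valring K, c != 0 /\ L (c *: m)] = L.

(* The image of k (x) L in k (x) M. *)
Definition tensor_sub (L : set M) : set (tensor M) :=
  [set w | exists2 s : seq (K * M),
     forall p, p \in s -> L p.2 & w = \sum_(p <- s) pure_tensor p.1 p.2].

Definition generically_weakly_closed (L : set M) : Prop :=
  generically_complete /\ weakly_closed gauge (tensor_sub L).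

End GenericNotions.

Definition generically_weakly_simple (R : realType) (G : profiniteGroupType)
    (K : valuationFieldType R) (M : lmodType (iwasawa G K)) : Prop :=
  ([set L : set M | [/\ submod_closed (mem L),
       @generically_weakly_closed R K (restricted M) L &
       @pure_submodule R K (restricted M) L]] #= `I_2)%card.

(* Main.v *)
Require Import Defs.
From mathcomp Require Import all_boot all_order all_algebra monoid.
From mathcomp Require Import all_classical all_reals topology.
From mathcomp Require Import finmap ring lra.

Set Implicit Arguments.
Unset Strict Implicit.
Unset Printing Implicit Defensive.

Import Order.TTheory GRing.Theory Num.Theory.
Local Open Scope classical_set_scope.
Local Open Scope ring_scope.

(** Taking annihilators matches the weakly closed subrepresentations [W] of [V]
    with the pure, generically weakly closed submodules [L] of its dual, and both
    sides then have the same number of members.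

    Stability under the group corresponds on both sides for a simple reason: an
    element [mu] of the Iwasawa algebra acts on [m] by integrating the function
    [g |-> m (g^-1 v)], which is identically zero when [m] kills a stable subspace
    containing [v]; conversely the group elements lie in the algebra.

    That [W] is the common kernel of its annihilator is [annihilatorK].  It rests on
    [separation]: the weak topology is generated by functionals, so a point outside
    a weakly closed subspace is separated from it by finitely many of them, and
    linear algebra combines these into a single one.

    That [L] is the full annihilator of its common kernel is [coannihilatorK].
    The same argument on the scalar extension of the dual separates an element from
    [L] by a bounded functional on the dual, and [reflexivity] makes this
    functional the evaluation at a vector of [V].  In coordinates, [V] is the space
    of families on [I] tending to zero, its dual is the space of bounded families,
    and the claim is that every bounded functional [phi] on the latter is a sum
    against a family tending to zero ([functional_csum]).

    For sequences this is where non-spherical completeness enters.  If [phi] kills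
    all unit sequences, it factors through bounded sequences modulo finite ones, a
    spherically complete space; its image [K] would be spherically complete too
    unless [phi] is zero ([functional_eq0]).  Comparing with a shift, the values of
    any [phi] on unit sequences get arbitrarily small ([functional_unit_small]).
    For general [I], a functional killing the unit functions defines a countably
    additive [K]-valued measure that vanishes on points.  If its total mass is not
    zero, no infinite family of disjoint sets can have measures bounded away from
    zero, so some big set does not split into two big sets, and it carries a
    countably complete nonprincipal ultrafilter ([measure_of_eq0]).  On a
    non-measurable [I] the functional is therefore zero. *)

(** * Bounded functionals on bounded sequences *)

Section BoundedFunctions.
Variables (R : realType) (K : valuationFieldType R).

Lemma absv_sum_le (J : Type) (s : seq J) (F : J -> K) (M : R) :
  0 <= M -> (forall j, absv (F j) <= M) -> absv (\sum_(j <- s) F j) <= M.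
Proof.
move=> M0 FM; elim/big_ind: _ => //; first by rewrite absv0.
by move=> x y xM yM; rewrite (le_trans (absvD_max _ _))// ge_max xM.
Qed.

Lemma absvB_le (x y : K) (M : R) : absv x <= M -> absv y <= M -> absv (x - y) <= M.
Proof. by move=> xM yM; rewrite (le_trans (absvB_max _ _))// ge_max xM. Qed.

Lemma absvD_le (x y : K) (M : R) : absv x <= M -> absv y <= M -> absv (x + y) <= M.
Proof. by move=> xM yM; rewrite (le_trans (absvD_max _ _))// ge_max xM. Qed.

Lemma exists_inv_natS_lt (e : R) : 0 < e ->
  exists N, forall n, (N <= n)%N -> n.+1%:R^-1 < e.
Proof.
move=> e0; exists (Num.truncn e^-1) => n Nn.
rewrite invf_plt ?posrE// (lt_le_trans (truncnS_gt _))// ler_nat ltnS //.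
Qed.

(** The nonincreasing radii [s] majorise the jumps of the centres strictly, which
    leaves room to lift those jumps along a quotient map whose norm is an
    infimum that need not be attained. *)
Lemma nested_balls : non_spherically_complete K ->
  exists (c : nat -> K) (s : nat -> R),
    [/\ forall n, absv (c n.+1 - c n) < s n,
        forall m n, (m <= n)%N -> s n <= s m &
        forall x, exists n, s n < absv (x - c n)].
Proof.
move=> [c [r /= [fip cap0]]].
pose B n := [set x : K | absv (x - c n) <= r n].
have inter n : exists x, forall j, (j <= n)%N -> B j x.
  have [|x hx] := fip [fset j in iota 0 n.+1]%fset.
    by move=> j _; exact: mem_set.
  by exists x => j jn; apply: hx; apply/imfsetP; exists j => //=;
    rewrite -[_ :: _]/(iota 0 n.+1) mem_iota.
(* A ball of least radius would lie in all the others, as any two meet. *)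
have smaller j : exists m, r m < r j.
  apply: contrapT => /forallNP hm.
  suff : (\bigcap_n B n) (c j) by rewrite cap0.
  move=> m _; have rjm : r j <= r m by rewrite leNgt; apply/negP/hm.
  have [x hx] := inter (maxn j m).
  have xj := hx j (leq_maxl _ _); have xm := hx m (leq_maxr _ _).
  rewrite /B /= -(subrKA x); apply: absvD_le => //.
  by rewrite absv_distC (le_trans xj).
have [c' hc'] := choice inter.
pose t := (fix t (n : nat) : R := if n is n'.+1 then Num.min (t n') (r n) else r 0%N).
have t_le n j : (j <= n)%N -> t n <= r j.
  elim: n j => [|n IH] j; first by rewrite leqn0 => /eqP ->.
  rewrite leq_eqVlt => /predU1P[->|]; first by rewrite ge_min lexx orbT.
  by rewrite ltnS => /IH h; rewrite ge_min h.
have t_noninc m n : (m <= n)%N -> t n <= t m.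
  elim: n => [|n IH]; first by rewrite leqn0 => /eqP ->.
  rewrite leq_eqVlt => /predU1P[->//|]; rewrite ltnS => /IH h.
  by rewrite ge_min h.
have t_attained n : exists2 j, (j <= n)%N & t n = r j.
  elim: n => [|n [j jn tj]]; first by exists 0.
  have [h|h] := leP (t n) (r n.+1).
    by exists j; [exact: leqW|rewrite /= min_l].
  by exists n.+1 => //=; rewrite min_r// ltW.
exists c', (fun n => t n + n.+1%:R^-1); split.
- move=> n; rewrite (@le_lt_trans _ _ (t n))// ?ltrDl ?invr_gt0 ?ltr0n//.
  have [j jn ->] := t_attained n.
  rewrite -(subrKA (c j)); apply: absvD_le; first exact: hc' (leqW jn).
  by rewrite absv_distC; exact: hc'.
- move=> m n mn; apply: lerD; first exact: t_noninc.
  by rewrite lef_pV2 ?posrE ?ltr0n// ler_nat.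
- move=> x.
  have [j xj] : exists j, r j < absv (x - c j).
    apply: contrapT => /forallNP hx.
    suff : (\bigcap_n B n) x by rewrite cap0.
    by move=> j _; rewrite /B /= leNgt; apply/negP/hx.
  have [m rm] := smaller j.
  have [|N hN] := @exists_inv_natS_lt (r j - r m); first by rewrite subr_gt0.
  pose n := maxn N (maxn m j); exists n; rewrite ltNge; apply/negP => xn.
  have sn : t n + n.+1%:R^-1 <= r j.
    apply: (@le_trans _ _ (r m + (r j - r m))); last by rewrite subrKC.
    apply: lerD; last by apply/ltW/hN; rewrite leq_maxl.
    by apply: t_le; rewrite /n !leq_max leqnn !orbT.
  have : absv (x - c j) <= r j.
    rewrite -(subrKA (c' n)); apply: absvD_le; first exact: le_trans sn.
    by apply: hc'; rewrite /n !leq_max leqnn !orbT.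
  by rewrite leNgt xj.
Qed.

Definition bounded_by (I : Type) (f : I -> K) (M : R) :=
  forall i, absv (f i) <= M.

(** A continuous linear form on the space of bounded functions, carried by all
    functions: values on unbounded ones are unconstrained.  The bound asks for
    [0 <= M] because every [M] bounds the function on an empty index set. *)
Definition bounded_functional (I : Type) (phi : (I -> K) -> K) : Prop :=
  (forall a f g M, bounded_by f M -> bounded_by g M ->
     phi (fun i => a * f i + g i) = a * phi f + phi g) /\
  exists2 C, 0 < C &
    forall f M, 0 <= M -> bounded_by f M -> absv (phi f) <= C * M.

Definition unit_fun (I : choiceType) (i : I) : I -> K := fun j => (j == i)%:R.

Lemma absv_nat_bool (b : bool) : absv (b%:R : K) = b%:R.
Proof. by case: b; rewrite ?absv1 ?absv0. Qed.

Lemma bounded_by_unit (I : choiceType) (i : I) : bounded_by (unit_fun i) 1.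
Proof. by move=> j; rewrite absv_nat_bool; case: (j == i); rewrite ?ler01. Qed.

Lemma bounded_byW (I : Type) (f : I -> K) M M' :
  M <= M' -> bounded_by f M -> bounded_by f M'.
Proof. by move=> MM fM i; rewrite (le_trans (fM i)). Qed.

Lemma bounded_byZ (I : Type) a (f : I -> K) M :
  bounded_by f M -> bounded_by (fun i => a * f i) (absv a * M).
Proof. by move=> fM i; rewrite absvM ler_wpM2l ?absv_ge0. Qed.

Lemma bounded_byD (I : Type) a (f g : I -> K) M :
  bounded_by f M -> bounded_by g M ->
  bounded_by (fun i => a * f i + g i) (Num.max (absv a) 1 * M).
Proof.
move=> fM gM i; have M0 : 0 <= M by rewrite (le_trans (absv_ge0 (f i))).
apply: absvD_le.
  by rewrite absvM ler_pM ?absv_ge0 ?le_max ?lexx.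
by rewrite (le_trans (gM i))// ler_peMl// le_max lexx orbT.
Qed.

Section FunctionalTheory.
Variables (I : Type) (phi : (I -> K) -> K).
Hypothesis phiP : bounded_functional phi.

Lemma functional0 : phi (fun=> 0) = 0.
Proof.
have b0 : bounded_by (fun _ : I => 0 : K) 0 by move=> i; rewrite absv0.
have := phiP.1 (-1) _ _ _ b0 b0.
rewrite [X in phi X = _](_ : _ = fun _ : I => 0 : K).
  by rewrite mulN1r addNr.
by apply/funext => i; rewrite mulr0 addr0.
Qed.

Lemma functionalZ a f M : bounded_by f M -> phi (fun i => a * f i) = a * phi f.
Proof.
move=> fM; have f0 : bounded_by (fun i => 0 * f i) M.
  move=> i; rewrite mul0r absv0; exact: le_trans (absv_ge0 _) (fM i).
rewrite -[RHS]addr0 -functional0.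
have -> : (fun _ : I => 0 : K) = (fun i => 0 * f i).
  by apply/funext => i; rewrite mul0r.
rewrite -(phiP.1 a f _ M)//; congr phi; apply/funext => i.
by rewrite mul0r addr0.
Qed.

Lemma functionalD f g M : bounded_by f M -> bounded_by g M ->
  phi (fun i => f i + g i) = phi f + phi g.
Proof.
move=> fM gM; rewrite -[phi f]mul1r -(phiP.1 1 f g M)//; congr phi.
by apply/funext => i; rewrite mul1r.
Qed.

Lemma functionalB f g M : bounded_by f M -> bounded_by g M ->
  phi (fun i => f i - g i) = phi f - phi g.
Proof.
move=> fM gM; rewrite addrC -mulN1r -(phiP.1 _ _ _ M)//; congr phi.
by apply/funext => i; rewrite mulN1r addrC.
Qed.

End FunctionalTheory.

Lemma functional_comp (I J : Type) (T : (J -> K) -> I -> K) phi B :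
  bounded_functional phi -> 0 < B ->
  (forall a f g, T (fun j => a * f j + g j) = fun i => a * T f i + T g i) ->
  (forall f M, 0 <= M -> bounded_by f M -> bounded_by (T f) (B * M)) ->
  bounded_functional (fun f => phi (T f)).
Proof.
move=> [phiD [C C0 hC]] B0 TD TB; split.
  move=> a f g M fM gM; rewrite TD.
  have M0 : bounded_by f `|M| by apply: bounded_byW fM; exact: ler_norm.
  have M1 : bounded_by g `|M| by apply: bounded_byW gM; exact: ler_norm.
  by rewrite (phiD a _ _ (B * `|M|))//; apply: TB.
exists (C * B); first exact: mulr_gt0.
move=> f M M0 fM; rewrite -mulrA; apply: hC; last exact: TB.
by rewrite mulr_ge0// ltW.
Qed.

Lemma functional_sub (I : Type) (phi psi : (I -> K) -> K) :
  bounded_functional phi -> bounded_functional psi ->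
  bounded_functional (fun f => phi f - psi f).
Proof.
move=> [phiD [C C0 hC]] [psiD [D D0 hD]]; split.
  move=> a f g M fM gM; rewrite (phiD _ _ _ M)// (psiD _ _ _ M)//.
  by rewrite mulrBr opprD addrACA.
exists (Num.max C D); first by rewrite lt_max C0.
move=> f M M0 fM; apply: absvB_le.
  by rewrite (le_trans (hC _ _ M0 fM))// ler_wpM2r// le_max lexx.
by rewrite (le_trans (hD _ _ M0 fM))// ler_wpM2r// le_max lexx orbT.
Qed.

Lemma functional_finite (phi : (nat -> K) -> K) :
  bounded_functional phi -> (forall n, phi (unit_fun n) = 0) ->
  forall n f M, bounded_by f M -> (forall i, (n <= i)%N -> f i = 0) -> phi f = 0.
Proof.
move=> phiP phi0; elim=> [|n IH] f M fM fn.
  by rewrite -(functional0 phiP); congr phi; apply/funext => i; exact: fn.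
have -> : f = (fun i => f n * unit_fun n i + (if i == n then 0 else f i)).
  apply/funext => i; rewrite /unit_fun; case: eqP => [->|_].
    by rewrite mulr1 addr0.
  by rewrite mulr0 add0r.
have M0 : 0 <= M by rewrite (le_trans (absv_ge0 (f 0%N))).
pose g i := if i == n then 0 else f i.
have gM : bounded_by g M by move=> i; rewrite /g; case: eqP => // _; rewrite absv0.
rewrite (phiP.1 _ _ _ (Num.max M 1)).
- rewrite phi0 mulr0 add0r; apply: (IH g M gM) => i ni; rewrite /g.
  by case: eqP => // /eqP ni'; apply: fn; rewrite ltn_neqAle eq_sym ni'.
- by apply: bounded_byW (bounded_by_unit n); rewrite le_max lexx orbT.
- by apply: bounded_byW gM; rewrite le_max lexx.
Qed.

(** A nonzero [phi] would make [K], up to rescaling its norm, a quotient of the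
    space of bounded sequences modulo finite ones.  That quotient is spherically
    complete by a diagonal construction, and spherical completeness passes to
    quotients. *)
Lemma functional_eq0 (phi : (nat -> K) -> K) : non_spherically_complete K ->
  bounded_functional phi -> (forall n, phi (unit_fun n) = 0) ->
  forall f M, bounded_by f M -> phi f = 0.
Proof.
move=> nsph phiP phi0 f1 M1 f1M; apply: contrapT => /eqP phif1.
have [C C0 hC] := phiP.2.
have bge0 (f : nat -> K) M : bounded_by f M -> 0 <= M.
  by move=> fM; rewrite (le_trans (absv_ge0 (f 0%N))).
pose S := [set M | exists2 f, bounded_by f M & phi f = 1].
have S0 : has_inf S.
  split; last by exists 0 => M [f fM _]; exact: bge0 fM.
  exists (absv (phi f1)^-1 * M1), (fun i => (phi f1)^-1 * f1 i).
    exact: bounded_byZ.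
  by rewrite (functionalZ phiP _ f1M) mulVf.
pose nu := inf S.
have nu0 : 0 < nu.
  rewrite (@lt_le_trans _ _ C^-1) ?invr_gt0//.
  apply: lb_le_inf; first exact: S0.1.
  move=> M [f fM f1E]; have := hC f M (bge0 _ _ fM) fM.
  by rewrite f1E absv1 -ler_pdivrMl// mulr1.
(* The strict inequality [absv x < t] makes up for [nu] possibly
   not being attained. *)
have lift x t : absv x < t -> exists g, bounded_by g (nu * t) /\ phi g = x.
  move=> xt; have t0 : 0 < t by rewrite (le_lt_trans (absv_ge0 x)).
  have [->|x0] := eqVneq x 0.
    exists (fun=> 0); split; last exact: functional0.
    by move=> i; rewrite absv0 mulr_ge0 ?ltW.
  have x0' := absv_gt0 x0.
  have [|M [f fM fE] Mlt] := @inf_adherent _ S ((t / absv x - 1) * nu) _ S0.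
    by rewrite mulr_gt0// subr_gt0 ltr_pdivlMr// mul1r.
  exists (fun i => x * f i); split; last by rewrite (functionalZ phiP _ fM) fE mulr1.
  apply: bounded_byW (bounded_byZ x fM).
  have : M <= t / absv x * nu by rewrite (le_trans (ltW Mlt))// -/nu mulrBl mul1r; lra.
  move=> h; rewrite mulrC -ler_pdivlMr// (le_trans h)//.
  by rewrite mulrAC [t * nu]mulrC.
have bound h M : bounded_by h (nu * M) -> absv (phi h) <= M.
  move=> hM; have [y0|y0] := eqVneq (phi h) 0.
    by rewrite y0 absv0; have := bge0 _ _ hM; rewrite pmulr_rge0.
  have : S (absv (phi h)^-1 * (nu * M)).
    exists (fun i => (phi h)^-1 * h i); first exact: bounded_byZ.
    by rewrite (functionalZ phiP _ hM) mulVf.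
  move=> /(ge_inf S0.2); rewrite -/nu absvV mulrC -mulrA.
  rewrite -[X in X <= _]mulr1 ler_pM2l// ler_pdivlMr ?absv_gt0// mul1r//.
have [c [s [cs sni xs]]] := nested_balls nsph.
have [g hg] := choice (fun n => lift (c n.+1 - c n) (s n) (cs n)).
have sge0 n : 0 <= s n by rewrite (le_trans (absv_ge0 (c n.+1 - c n)))// ltW.
(* The diagonal sum agrees with each partial sum off finitely many indices, up
   to an error of the size of the next terms. *)
pose tail n i := \sum_(n <= j < i.+1) g j i.
have tail_bound n : bounded_by (tail n) (nu * s n).
  move=> i; rewrite /tail big_nat_cond.
  have M0 : 0 <= nu * s n by rewrite mulr_ge0// ltW.
  elim/big_ind: _ => //; first by rewrite absv0.
    by move=> x y; exact: absvD_le.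
  move=> j /andP[/andP[nj _] _]; rewrite (le_trans ((hg j).1 i))//.
  by rewrite ler_pM2l// sni.
have partial n : phi (tail 0%N) = c n - c 0%N + phi (tail n).
  elim: n => [|n ->]; first by rewrite subrr add0r.
  have -> : phi (tail n) = c n.+1 - c n + phi (tail n.+1).
    have gn := (hg n).1; have tn := tail_bound n; have tn1 := tail_bound n.+1.
    have tn1' : bounded_by (tail n.+1) (nu * s n).
      by apply: bounded_byW tn1; rewrite ler_pM2l// sni.
    apply/eqP; rewrite -subr_eq0 opprD addrA -(hg n).2.
    rewrite -(functionalB phiP tn gn).
    have tg : bounded_by (fun i => tail n i - g n i) (nu * s n).
      by move=> i; exact: absvB_le.
    rewrite -(functionalB phiP tg tn1'); apply/eqP.
    apply: (functional_finite phiP phi0 (n := n) (M := nu * s n)).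
      by move=> i; exact: absvB_le.
    by move=> i ni; rewrite /tail big_ltn// [g n i + _]addrC addrK subrr.
  by ring.
have [n] := xs (c 0%N + phi (tail 0%N)).
rewrite (partial n) addrA [c 0%N + _]addrC subrK addrAC subrr add0r.
by rewrite ltNge bound.
Qed.

(** If all these values had absolute value at least [e], a bounded rescaling
    would turn them into 1.  The rescaled functional differs from its composite
    with the right shift by one that kills all unit sequences, hence vanishes by
    [functional_eq0]; yet the constant sequence 1 and its shift differ by a unit
    sequence. *)
Lemma functional_unit_small (phi : (nat -> K) -> K) e :
  non_spherically_complete K -> bounded_functional phi -> 0 < e ->
  exists n, absv (phi (unit_fun n)) < e.
Proof.
move=> nsph phiP e0; apply: contrapT => /forallNP phie.
have {}phie n : e <= absv (phi (unit_fun n)) by rewrite leNgt; apply/negP/phie.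
have phin0 n : phi (unit_fun n) != 0.
  by apply/eqP => h; have := phie n; rewrite h absv0 leNgt e0.
pose T (f : nat -> K) n := (phi (unit_fun n))^-1 * f n.
have TP : bounded_functional (fun f => phi (T f)).
  apply: (@functional_comp _ _ T phi e^-1); rewrite ?invr_gt0//.
    by move=> a f g; apply/funext => n; rewrite /T; ring.
  move=> f M M0 fM n; rewrite absvM absvV ler_pM ?absv_ge0 ?invr_ge0 ?absv_ge0//.
  by rewrite lef_pV2 ?posrE ?absv_gt0.
have T1 n : phi (T (unit_fun n)) = 1.
  have -> : T (unit_fun n) = fun j => (phi (unit_fun n))^-1 * unit_fun n j.
    apply/funext => j; rewrite /T {2 4}/unit_fun.
    by case: eqP => [->//|_]; rewrite !mulr0.
  by rewrite (functionalZ phiP _ (bounded_by_unit n)) mulVf.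
pose S (f : nat -> K) n := if n is n'.+1 then f n' else 0.
have SP : bounded_functional (fun f => phi (T (S f))).
  apply: (@functional_comp _ _ S (fun f => phi (T f)) 1) => //.
    by move=> a f g; apply/funext => -[|n] //=; rewrite mulr0 addr0.
  by move=> f M M0 fM [|n] /=; rewrite mul1r ?absv0.
have b1 : bounded_by (fun _ : nat => 1 : K) 1 by move=> n; rewrite absv1.
have bS : bounded_by (S (fun=> 1)) 1 by move=> [|n] /=; rewrite ?absv0 ?absv1 ?ler01.
have : phi (T (fun=> 1)) - phi (T (S (fun=> 1))) = 0.
  apply: (functional_eq0 nsph (functional_sub TP SP) _ b1) => n.
  rewrite T1 (_ : S (unit_fun n) = unit_fun n.+1) ?T1 ?subrr//.
  by apply/funext => -[].
rewrite -(functionalB TP b1 bS).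
rewrite (_ : (fun i => _) = unit_fun 0%N :> (nat -> K)).
  by rewrite T1 => /eqP; rewrite oner_eq0.
by apply/funext => -[|n] /=; rewrite /unit_fun ?subr0 ?subrr.
Qed.

(** * The measure of a functional and measurable cardinals *)

Section Measures.
Hypothesis nsph : non_spherically_complete K.
Variables (I : choiceType) (phi : (I -> K) -> K) (h : I -> K) (H : R).
Hypotheses (phiP : bounded_functional phi) (hH : bounded_by h H).

(** Weighting by [h] turns the value of [phi] at [h] into a total mass. *)
Definition measure_of (A : set I) : K := phi (fun i => (i \in A)%:R * h i).

Lemma bounded_by_restrict (A : set I) : bounded_by (fun i => (i \in A)%:R * h i) H.
Proof.
move=> i; case: (i \in A); rewrite ?mul1r ?mul0r ?absv0//.
exact: le_trans (absv_ge0 _) (hH i).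
Qed.

Lemma measure_ofU A B : A `&` B = set0 ->
  measure_of (A `|` B) = measure_of A + measure_of B.
Proof.
move=> AB0; rewrite /measure_of.
rewrite -(functionalD phiP (bounded_by_restrict A) (bounded_by_restrict B)).
congr phi; apply/funext => i; rewrite in_setU -mulrDl; congr (_ * _).
have : ~~ ((i \in A) && (i \in B)) by rewrite -in_setI AB0 in_set0.
by case: (i \in A); case: (i \in B) => //= _; rewrite ?addr0 ?add0r.
Qed.

Lemma measure_of0 : measure_of set0 = 0.
Proof.
have /eqP := measure_ofU (set0I (@set0 I)).
by rewrite setU0 -subr_eq0 opprD addNKr oppr_eq0 => /eqP.
Qed.

Lemma measure_of1 i : phi (unit_fun i) = 0 -> measure_of [set i] = 0.
Proof.
move=> phi0; rewrite /measure_of (_ : (fun j => _) = fun j => h i * unit_fun i j).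
  by rewrite (functionalZ phiP _ (bounded_by_unit i)) phi0 mulr0.
apply/funext => j; rewrite /unit_fun in_set1; case: eqP => [->|_].
  by rewrite mulrC.
by rewrite mulr0 mul0r.
Qed.

(** Weighting the fibres of [rk] by a bounded sequence turns [phi] into a
    functional on sequences, to which [functional_unit_small] applies. *)
Lemma measure_of_fibre (rk : I -> nat) e (A : set I) : 0 < e ->
  exists n, absv (measure_of [set i | A i /\ rk i = n]) < e.
Proof.
move=> e0; pose T (b : nat -> K) i := b (rk i) * ((i \in A)%:R * h i).
have TP : bounded_functional (fun b => phi (T b)).
  apply: (@functional_comp _ _ T phi (`|H| + 1)) => //.
  - by rewrite ltr_pwDr.
  - by move=> a f g; apply/funext => i; rewrite /T; ring.
  - move=> b M M0 bM i; rewrite absvM mulrC ler_pM ?absv_ge0//.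
    rewrite (le_trans (bounded_by_restrict A i))// (le_trans (ler_norm _))//.
    by rewrite lerDl.
have [n hn] := functional_unit_small nsph TP e0; exists n.
congr (absv (phi _) < e): hn; apply/funext => i; rewrite /T /unit_fun mulrA.
congr (_ * _); rewrite -natrM mulnb; congr (_%:R); congr nat_of_bool.
apply/idP/idP => [/andP[/eqP ri iA]|/set_mem[Ai <-]]; last by rewrite eqxx mem_set.
by apply/mem_set; split => //; exact/set_mem.
Qed.

(** Here summing a bounded sequence up to [rk] stays bounded because the
    absolute value is ultrametric. *)
Lemma measure_of_tail (rk : I -> nat) e (A : set I) : 0 < e ->
  exists n, absv (measure_of [set i | A i /\ (n <= rk i)%N]) < e.
Proof.
move=> e0.
pose T (b : nat -> K) i := (\sum_(j < (rk i).+1) b j) * ((i \in A)%:R * h i).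
have TP : bounded_functional (fun b => phi (T b)).
  apply: (@functional_comp _ _ T phi (`|H| + 1)) => //.
  - by rewrite ltr_pwDr.
  - move=> a f g; apply/funext => i; rewrite /T big_split /= -mulr_sumr; ring.
  - move=> b M M0 bM i; rewrite absvM mulrC ler_pM ?absv_ge0//.
      rewrite (le_trans (bounded_by_restrict A i))// (le_trans (ler_norm _))//.
      by rewrite lerDl.
    exact: absv_sum_le.
have [n hn] := functional_unit_small nsph TP e0; exists n.
congr (absv (phi _) < e): hn; apply/funext => i; rewrite /T /unit_fun mulrA.
congr (_ * _); have [ni|ni] := leqP n (rk i).
  have nlt : (n < (rk i).+1)%N by rewrite ltnS.
  rewrite (bigD1 (Ordinal nlt))//= eqxx big1 ?addr0 => [|j]; last first.
    by rewrite -val_eqE /= => /negPf ->.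
  rewrite mul1r; congr (_%:R); congr nat_of_bool.
  by apply/idP/idP => [/set_mem Ai|/set_mem[Ai _]]; apply/mem_set.
rewrite big1 ?mul0r => [|j _].
  rewrite (_ : (_ \in _) = false)//; apply/negP => /set_mem[_].
  by rewrite leqNgt ni.
by rewrite (ltn_eqF (leq_trans (ltn_ord j) ni)).
Qed.

Definition big e (A : set I) := exists2 B, B `<=` A & e <= absv (measure_of B).

Lemma bigS e A B : A `<=` B -> big e A -> big e B.
Proof. by move=> AB [C CA Ce]; exists C => //; exact: subset_trans AB. Qed.

Lemma big_set0 e : 0 < e -> ~ big e set0.
Proof.
move=> e0 [B]; rewrite subset0 => ->.
by rewrite measure_of0 absv0 leNgt e0.
Qed.

Lemma bigU e A B : big e (A `|` B) -> big e A \/ big e B.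
Proof.
move=> [C CAB Ce]; have [hA|nA] := pselect (big e A); first by left.
right; apply: contrapT => nB.
have small D (E : set I) : ~ big e D -> E `<=` D -> absv (measure_of E) < e.
  by move=> nD ED; rewrite ltNge; apply/negP => Ee; apply: nD; exists E.
move: Ce; rewrite leNgt => /negP; apply.
rewrite -(setUIDK C A) measure_ofU; last first.
  by apply/seteqP; split => i // -[[_ Ai] [_ /(_ Ai)]].
rewrite (le_lt_trans (absvD_max _ _))// gt_max (small A)//= (small B)//.
by move=> i [/CAB[]].
Qed.

(** A set of [e]-large measure in the union splits into the part met by finitely
    many [A n] and a tail, whose measure is small by [measure_of_tail]. *)
Lemma big_bigcup e (A : nat -> set I) : 0 < e ->
  big e (\bigcup_n A n) -> exists n, big e (A n).
Proof.
move=> e0 [C CA Ce]; apply: contrapT => /forallNP nA.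
have /choice[rk hrk] : forall i, exists n, C i -> A n i.
  move=> i.
  have [/CA[n _ An]|nC] := pselect (C i); first by exists n.
  by exists 0%N.
have [n hn] := measure_of_tail rk C e0.
have head m : ~ big e [set i | C i /\ (rk i < m)%N].
  elim: m => [|m IH].
    by move=> b; apply: (big_set0 e0); apply: bigS b => i [].
  move=> hb; have : big e ([set i | C i /\ (rk i < m)%N] `|` A m).
    apply: bigS hb => i [Ci]; rewrite ltnS leq_eqVlt => /predU1P[<-|lt].
      by right; exact: hrk.
    by left.
  by move=> /bigU[//|]; exact: nA.
have CE : C = [set i | C i /\ (rk i < n)%N] `|` [set i | C i /\ (n <= rk i)%N].
  apply/seteqP; split => [i Ci|i [[]|[]]//].
  by have [|] := leqP n (rk i); [right|left].
move: Ce; rewrite CE measure_ofU; last first.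
  by apply/seteqP; split => i // -[[_ +] [_ +]] /=; rewrite ltnNge => /negP.
apply/negP; rewrite -ltNge (le_lt_trans (absvD_max _ _))// gt_max hn andbT.
by rewrite ltNge; apply/negP => he; apply: (head n); eexists; [|exact: he].
Qed.

(** Splitting big sets for ever would produce infinitely many disjoint sets of
    measure at least [e], which [measure_of_fibre] excludes. *)
Lemma big_atom e : 0 < e -> big e setT ->
  exists2 A, big e A & forall B, ~ (big e (A `&` B) /\ big e (A `\` B)).
Proof.
move=> e0 bigT; apply: contrapT => natom.
have /choice[f hf] : forall A, exists B, big e A ->
    big e (A `&` B) /\ big e (A `\` B).
  move=> A; have [bA|nA] := pselect (big e A); last by exists set0.
  apply: contrapT => nB; apply: natom; exists A => // B hB; apply: nB.
  by exists B.
pose A := fix A n := if n is n'.+1 then A n' `&` f (A n') else [set: I].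
have bigA n : big e (A n) by elim: n => //= n /hf[].
have /choice[C hC] : forall n, exists C,
    C `<=` A n `\` f (A n) /\ e <= absv (measure_of C).
  move=> n; have [_ [C CA Ce]] := hf _ (bigA n).
  by exists C.
have Amono m n i : (m <= n)%N -> A n i -> A m i.
  elim: n => [|n IH]; first by rewrite leqn0 => /eqP ->.
  rewrite leq_eqVlt => /predU1P[->//|]; rewrite ltnS => mn [Ani _].
  exact: IH.
have disj m n i : C m i -> C n i -> m = n.
  wlog mn : m n / (m <= n)%N => [wl|].
    by have [/wl//|/ltnW/wl wl'] := leqP m n; move=> ? ?; rewrite wl'.
  move=> /(hC m).1[_ nf] /(hC n).1[An _]; apply/eqP.
  rewrite eqn_leq mn /= leqNgt; apply/negP => lt; apply: nf.
  by have [] := Amono _ _ _ lt An.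
have /choice[rk hrk] : forall i, exists m, forall n, C n i -> m = n.
  move=> i.
  have [[m Cm]|nC] := pselect (exists m, C m i).
    by exists m => n; exact: disj.
  by exists 0%N => n Cn; case: nC; exists n.
have [n] := measure_of_fibre rk (\bigcup_n C n) e0.
rewrite (_ : [set i | _] = C n); first by rewrite ltNge (hC n).2.
apply/seteqP; split => [i [[m _ Cm]]|i Cn]; last by split; [exists n|exact: hrk].
by rewrite (hrk _ _ Cm) => <-.
Qed.

Hypothesis phi0 : forall i, phi (unit_fun i) = 0.

Lemma big_subset1 e (A : set I) i : 0 < e -> A `<=` [set i] -> ~ big e A.
Proof.
move=> e0 Ai [B /(subset_trans)/(_ Ai)/subset_set1[]->].
  by rewrite measure_of0 absv0 leNgt e0.
by rewrite measure_of1// absv0 leNgt e0.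
Qed.

(** A set that cannot be split into two big sets carries the countably complete
    ultrafilter of the sets with non-big relative complement. *)
Lemma measure_of_eq0 : non_measurable I -> measure_of setT = 0.
Proof.
move=> nmeas; apply: contrapT => /eqP mu0; apply: nmeas.
pose e := absv (measure_of setT).
have e0 : 0 < e by exact: absv_gt0.
have bigT : big e setT by exists setT.
split.
  move=> /countable_injP[g /in2TT ginj].
  have : big e (\bigcup_n [set i | g i = n]).
    by apply: bigS bigT => i _; exists (g i).
  move=> /(big_bigcup e0)[n bign].
  have [[i gi]|no] := pselect (exists i, g i = n).
    apply: (big_subset1 (i := i) e0 _ bign) => j /= gj; apply: ginj.
    by rewrite gj.
  apply: (big_set0 e0); apply: bigS bign => i gi.
  by apply: no; exists i.
have [A bigA atomA] := big_atom e0 bigT.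
pose F : set_system I := [set B | ~ big e (A `\` B)].
have FF : ProperFilter F.
  apply: Build_ProperFilter_ex => [B FB|].
    apply: contrapT => /forallNP nB; apply: FB; apply: bigS bigA => i Ai.
    by split=> //; exact: nB.
  split.
  - by move=> b; apply: (big_set0 e0); apply: bigS b => i [_]; apply.
  - move=> B C FB FC; rewrite /F /= setDIr => /bigU[]//.
  - move=> B C BC FB b; apply: FB; apply: bigS b => i [Ai nC].
    by split=> // /BC.
exists F; split.
- split=> // G GF FG; apply/seteqP; split=> // B GB b.
  have : F (~` B).
    move=> b'; apply: (atomA B); split => //.
    by move: b'; rewrite setDE setCK.
  move=> /FG GnB; have [i []] := filter_ex (filterI GB GnB).
  by move=> Bi nBi; apply: nBi.
- move=> i Fi; have : F [set i] by rewrite Fi; apply/principal_filterP.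
  move=> nb; have : big e ((A `\` [set i]) `|` [set i]).
    apply: bigS bigA => j Aj; have [->|ji] := pselect (j = i); first by right.
    by left.
  by move=> /bigU[//|]; exact: (big_subset1 (i := i)).
- move=> B FB; rewrite /F /= setDE setC_bigcap setI_bigcupr.
  by move=> /(big_bigcup e0)[n]; exact: FB.
Qed.

End Measures.

Lemma functional_eq0_nonmeasurable (I : choiceType) (phi : (I -> K) -> K) :
  non_spherically_complete K -> non_measurable I -> bounded_functional phi ->
  (forall i, phi (unit_fun i) = 0) -> forall f M, bounded_by f M -> phi f = 0.
Proof.
move=> nsph nmeas phiP phi0 f M fM.
rewrite -(measure_of_eq0 nsph phiP fM phi0 nmeas); congr phi.
by apply/funext => i; rewrite mem_set// mul1r.
Qed.

End BoundedFunctions.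

(** * Sums of families tending to zero *)

Section SummableFamilies.
Variables (R : realType) (K : valuationFieldType R) (I : choiceType).
Implicit Types u w : I -> K.

Definition finitely_supported u := finite_set [set i | u i <> 0].

Definition finsum u : K := \sum_(i \in [set: I]) u i.

Lemma finitely_supportedD a u w : finitely_supported u -> finitely_supported w ->
  finitely_supported (fun i => a * u i + w i).
Proof.
move=> fu fw; have fuw : finite_set ([set i | u i <> 0] `|` [set i | w i <> 0]).
  by rewrite finite_setU.
apply: sub_finite_set fuw => i /= uw; apply: contrapT => /not_orP[/contrapT ui /contrapT wi].
by apply: uw; rewrite ui wi mulr0 addr0.
Qed.

Lemma finsumD a u w : finitely_supported u -> finitely_supported w ->
  finsum (fun i => a * u i + w i) = a * finsum u + finsum w.
Proof.
move=> fu fw; pose D := [set i | u i <> 0] `|` [set i | w i <> 0].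
have finD : finite_set D by rewrite finite_setU.
have supp v : (forall i, ~ D i -> v i = 0) -> finsum v = \sum_(i \in D) v i.
  by move=> vD; symmetry; apply: fsbig_widen => // i [_ /vD].
have uD i : ~ D i -> u i = 0 by move=> /not_orP[/contrapT].
have wD i : ~ D i -> w i = 0 by move=> /not_orP[_ /contrapT].
rewrite !supp//; last by move=> i nD; rewrite uD// wD// mulr0 addr0.
by rewrite fsbig_split//= mulr_fsumr.
Qed.

Lemma finsum_le u M : 0 <= M -> bounded_by u M -> absv (finsum u) <= M.
Proof. by move=> M0 uM; exact: absv_sum_le. Qed.

Lemma finsumB_le u w M : finitely_supported u -> finitely_supported w -> 0 <= M ->
  (forall i, absv (u i - w i) <= M) -> absv (finsum u - finsum w) <= M.
Proof.
move=> fu fw M0 uwM; rewrite addrC -mulN1r -finsumD//; apply: finsum_le => // i.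
by rewrite mulN1r addrC.
Qed.

Definition truncate e u i : K := if e <= absv (u i) then u i else 0.

Lemma truncate_near e u i : 0 <= e -> absv (u i - truncate e u i) <= e.
Proof.
move=> e0; rewrite /truncate; case: ifPn => [_|]; first by rewrite subrr absv0.
by rewrite -ltNge subr0 => /ltW.
Qed.

Lemma finitely_supported_truncate e u : 0 < e -> C0 (u : I -> K^o) ->
  finitely_supported (truncate e u).
Proof.
move=> e0 /(_ e e0); apply: sub_finite_set => i /=.
by rewrite /truncate; case: ifP.
Qed.

Lemma C0_bounded u : C0 (u : I -> K^o) -> exists2 M, 0 <= M & bounded_by u M.
Proof.
move=> u0.
have [s hs] : exists s : seq I, forall i, 1 <= absv (u i) -> i \in s.
  have /finite_seqP[s hs] := u0 1 ltr01.
  by exists s => i ui; have : [set` s] i by rewrite -hs.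
exists (1 + \sum_(i <- s) absv (u i)).
  by rewrite addr_ge0// sumr_ge0// => i _; exact: absv_ge0.
move=> i; have [ui|ui] := leP 1 (absv (u i)); last first.
  by rewrite (le_trans (ltW ui))// lerDl sumr_ge0// => j _; exact: absv_ge0.
rewrite (perm_big _ (perm_to_rem (hs i ui))) big_cons /= addrCA lerDl.
by rewrite addr_ge0// sumr_ge0// => j _; exact: absv_ge0.
Qed.

(** Approximating by finitely supported families rather than by finite index sets
    exhibits the sum as the continuous extension of [finsum], and makes linearity
    independent of any common index set. *)
Definition is_csum u (l : K) := forall e w, 0 < e -> finitely_supported w ->
  (forall i, absv (u i - w i) <= e) -> absv (l - finsum w) <= e.

Lemma is_csum_exists u : C0 (u : I -> K^o) -> exists l, is_csum u l.
Proof.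
move=> u0; pose w n := truncate n.+1%:R^-1 u.
have d0 n : 0 < n.+1%:R^-1 :> R by rewrite invr_gt0 ltr0n.
have wfin n : finitely_supported (w n) by exact: finitely_supported_truncate.
have near n i : absv (u i - w n i) <= n.+1%:R^-1.
  by apply: truncate_near; exact: ltW.
have [|l hl] := @absv_complete R K (fun n => finsum (w n)).
  move=> e e0; have [N hN] := exists_inv_natS_lt e0.
  exists N => m n Nm Nn.
  rewrite (@le_lt_trans _ _ (Num.max m.+1%:R^-1 n.+1%:R^-1))//; last first.
    by rewrite gt_max !hN.
  apply: finsumB_le => // [|i]; first by rewrite le_max ltW.
  rewrite -(subrKA (u i)); apply: absvD_le.
    by rewrite absv_distC (le_trans (near _ _))// le_max lexx.
  by rewrite (le_trans (near _ _))// le_max lexx orbT.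
exists l => e v e0 vfin uv.
have [N1 hN1] := hl e e0; have [N2 hN2] := exists_inv_natS_lt e0.
pose n := maxn N1 N2; rewrite -(subrKA (finsum (w n))); apply: absvD_le.
  by rewrite absv_distC ltW// hN1 ?leq_maxl.
apply: finsumB_le => // [|i]; first exact: ltW.
rewrite -(subrKA (u i)); apply: absvD_le => //.
by rewrite absv_distC (le_trans (near _ _))// ltW// hN2 ?leq_maxr.
Qed.

Definition csum u : K := xget 0 [set l | is_csum u l].

Lemma csumP u : C0 (u : I -> K^o) -> is_csum u (csum u).
Proof. by move=> /is_csum_exists[l hl]; exact: (xgetI 0 hl). Qed.

Lemma csum_le u M : C0 (u : I -> K^o) -> 0 <= M -> bounded_by u M ->
  absv (csum u) <= M.
Proof.
move=> u0 M0 uM; apply/ler_addgt0Pl => e e0.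
have fin0 : finitely_supported (fun=> 0).
  by rewrite /finitely_supported (_ : [set _ | _] = set0)//; apply/seteqP; split.
have := csumP u0 (e := e + M) (w := fun=> 0).
rewrite [finsum _]big1// subr0; apply=> //; first exact: ltr_pwDl.
by move=> i; rewrite subr0 (le_trans (uM i))// lerDr ltW.
Qed.

Lemma eq0_absv_le (x : K) : (forall e, 0 < e -> absv x <= e) -> x = 0.
Proof.
move=> h; apply/absv_eq0/le_anti; rewrite absv_ge0 andbT.
by apply/ler_addgt0Pl => e e0; rewrite addr0 h.
Qed.

Lemma C0D a u w : C0 (u : I -> K^o) -> C0 (w : I -> K^o) ->
  C0 ((fun i => a * u i + w i) : I -> K^o).
Proof.
move=> u0 w0 e e0; pose d := e / Num.max (absv a) 1.
have m0 : 0 < Num.max (absv a) 1 by rewrite lt_max ltr01 orbT.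
have d0 : 0 < d by rewrite divr_gt0.
have fuw : finite_set ([set i | d <= absv (u i)] `|` [set i | e <= absv (w i)]).
  by rewrite finite_setU; split; [exact: u0|exact: w0].
apply: sub_finite_set fuw => i /= ei.
have [|wi] := leP e (absv (w i)); [by right|left].
rewrite leNgt; apply/negP => ui; move: ei; rewrite leNgt => /negP; apply.
rewrite (le_lt_trans (absvD_max _ _))// gt_max wi andbT absvM.
move: ui; rewrite /d ltr_pdivlMr// mulrC => ui.
by rewrite (le_lt_trans _ ui)// ler_wpM2r ?absv_ge0// le_max lexx.
Qed.

Lemma C0M u w M : bounded_by w M -> C0 (u : I -> K^o) ->
  C0 ((fun i => w i * u i) : I -> K^o).
Proof.
move=> wM u0 e e0; pose N := `|M| + 1.
have N0 : 0 < N by rewrite ltr_pwDr.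
have := u0 (e / N) (divr_gt0 e0 N0); apply: sub_finite_set => i /=.
rewrite ler_pdivrMr// absvM mulrC => h; apply: (le_trans h).
rewrite ler_wpM2l ?absv_ge0// (le_trans (wM i))// (le_trans (ler_norm _))//.
by rewrite lerDl.
Qed.

Lemma C0_finite u : finitely_supported u -> C0 (u : I -> K^o).
Proof.
move=> fu e e0; apply: sub_finite_set fu => i /= ei ui.
by move: ei; rewrite ui absv0 leNgt e0.
Qed.

Lemma csumD a u w : C0 (u : I -> K^o) -> C0 (w : I -> K^o) ->
  csum (fun i => a * u i + w i) = a * csum u + csum w.
Proof.
move=> u0 w0; apply/eqP; rewrite -subr_eq0; apply/eqP/eq0_absv_le => e e0.
pose d := e / Num.max (absv a) 1.
have m0 : 0 < Num.max (absv a) 1 by rewrite lt_max ltr01 orbT.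
have d0 : 0 < d by rewrite divr_gt0.
have de : absv a * d <= e.
  by rewrite /d mulrCA ler_piMr ?(ltW e0)// ler_pdivrMr// mul1r le_max lexx.
have fu := finitely_supported_truncate d0 u0.
have fw := finitely_supported_truncate e0 w0.
have nu i := truncate_near u i (ltW d0); have nw i := truncate_near w i (ltW e0).
have := csumP (C0D a u0 w0) e0 (finitely_supportedD a fu fw).
have := csumP u0 d0 fu nu; have := csumP w0 e0 fw nw.
rewrite finsumD//; set x := csum u; set y := csum w; set z := csum _.
set y' := finsum _; set x' := finsum _ => hy hx hz.
have -> : z - (a * x + y) = (z - (a * x' + y')) - (a * (x - x') + (y - y')) by ring.
apply: absvB_le.
  apply: hz => i; rewrite opprD addrACA -mulrBr; apply: absvD_le => //.
  by rewrite absvM (le_trans _ de)// ler_wpM2l ?absv_ge0.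
by apply: absvD_le => //; rewrite absvM (le_trans _ de)// ler_wpM2l ?absv_ge0.
Qed.

Lemma csumZ a u : C0 (u : I -> K^o) -> csum (fun i => a * u i) = a * csum u.
Proof.
move=> u0.
have z0 : C0 ((fun=> 0) : I -> K^o).
  apply: C0_finite; rewrite /finitely_supported (_ : [set _ | _] = set0)//.
  by apply/seteqP; split.
have z : csum (fun=> 0) = 0.
  by apply: eq0_absv_le => e e0; apply: csum_le => // [|i]; rewrite ?absv0 ltW.
rewrite -[RHS]addr0 -z -csumD//; congr csum.
by apply/funext => i; rewrite addr0.
Qed.

Lemma csum_unit (a : K) i : csum (fun j => a * unit_fun K i j) = a.
Proof.
have fin : finitely_supported (fun j => a * unit_fun K i j).
  apply: sub_finite_set (finite_set1 i) => j /=; rewrite /unit_fun.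
  by case: eqP => // _; rewrite mulr0.
have finE : finsum (fun j => a * unit_fun K i j) = a.
  rewrite /finsum -(@fsbig_widen _ _ _ _ [set i])//.
    by rewrite fsbig_set1 /unit_fun eqxx mulr1.
  by move=> j [_ /= /eqP/negPf ji]; rewrite /unit_fun ji mulr0.
apply/eqP; rewrite -subr_eq0; apply/eqP/eq0_absv_le => e e0.
rewrite -{2}finE; apply: (csumP (C0_finite fin)) => // j.
by rewrite subrr absv0 ltW.
Qed.

(** Infinitely many large values would restrict to a sequence contradicting
    [measure_of_fibre] for the constant weight 1. *)
Lemma functional_units_C0 (Phi : (I -> K) -> K) : non_spherically_complete K ->
  bounded_functional Phi -> C0 ((fun i => Phi (unit_fun K i)) : I -> K^o).
Proof.
move=> nsph PhiP e e0; apply: contrapT => /infiniteP/card_leP[f].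
pose g n := set_val (f (to_setT n)).
have gA n : e <= absv (Phi (unit_fun K (g n))).
  exact: (set_valP (f (to_setT n))).
have ginj m n : g m = g n -> m = n.
  by move=> /val_inj/(@inj _ _ _ f); rewrite !in_setE => /(_ Logic.I Logic.I)/(congr1 val).
have /choice[rk hrk] : forall i, exists m, forall n, g n = i -> m = n.
  move=> i; have [[m gm]|no] := pselect (exists m, g m = i).
    by exists m => n gn; apply: ginj; rewrite gm.
  by exists 0%N => n gn; case: no; exists n.
have b1 : bounded_by (fun _ : I => 1 : K) 1 by move=> i; rewrite absv1.
have [n] := measure_of_fibre nsph PhiP b1 rk (range g) e0.
rewrite (_ : [set i | _] = [set g n]); last first.
  apply/seteqP; split => [i [[m _ gm]]|i ->].
    by rewrite (hrk _ _ gm) => <-.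
  by split; [exists n|exact: hrk].
rewrite ltNge; move/negP; apply; rewrite (le_trans (gA n))//.
rewrite /measure_of (_ : (fun i => _) = unit_fun K (g n))//.
by apply/funext => i; rewrite /unit_fun in_set1 mulr1.
Qed.

(** Both sides agree on unit functions, so their difference is zero by
    [functional_eq0_nonmeasurable].  This identifies the dual of the space of
    bounded functions with the space of families tending to zero. *)
Lemma functional_csum (Phi : (I -> K) -> K) : non_spherically_complete K ->
  non_measurable I -> bounded_functional Phi ->
  exists2 u, C0 (u : I -> K^o) &
    forall f M, bounded_by f M -> Phi f = csum (fun i => f i * u i).
Proof.
move=> nsph nmeas PhiP; pose u i := Phi (unit_fun K i).
have u0 : C0 (u : I -> K^o) by exact: functional_units_C0.
exists u => // f M fM; apply/eqP; rewrite -subr_eq0; apply/eqP.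
have [N N0 uN] := C0_bounded u0.
have sumP : bounded_functional (fun f => csum (fun i => f i * u i)).
  split.
    move=> a g h L gL hL; rewrite -csumD; [|exact: C0M gL u0|exact: C0M hL u0].
    by congr csum; apply/funext => i; ring.
  exists (N + 1); first by rewrite ltr_pwDr.
  move=> g L L0 gL; apply: csum_le; first exact: C0M gL u0.
    by rewrite mulr_ge0// addr_ge0.
  move=> i; rewrite absvM mulrC ler_pM ?absv_ge0// (le_trans (uN i))//.
  by rewrite lerDl.
apply: (functional_eq0_nonmeasurable nsph nmeas (functional_sub PhiP sumP) _ fM).
move=> i; rewrite (_ : (fun j => _) = fun j => u i * unit_fun K i j).
  by rewrite csum_unit subrr.
apply/funext => j; rewrite /unit_fun; case: eqP => [->|_]; first exact: mulrC.
by rewrite mul0r mulr0.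
Qed.

End SummableFamilies.

(** * Weakly closed subspaces *)

Lemma submod_closed_setP (S : pzRingType) (V : lmodType S) (A : set V) :
  submod_closed (mem A) <->
  A 0 /\ forall a u v, A u -> A v -> A (a *: u + v).
Proof.
split=> -[A0 Alin].
  split; first exact: set_mem.
  by move=> a u v Au Av; apply/set_mem/Alin; exact: mem_set.
split; first exact: mem_set.
by move=> a u v /set_mem Au /set_mem Av; apply/mem_set/Alin.
Qed.

Section WeakClosedness.
Variables (R : realType) (K : valuationFieldType R).
Variables (W : lmodType K) (nrm : W -> R).
Hypothesis nrm_ge0 : forall v, 0 <= nrm v.

Definition bounded_scalar (m : W -> K) : Prop :=
  scalar m /\ exists2 C, 0 <= C & forall v, absv (m v) <= C * nrm v.

Lemma scalarD (m : W -> K) : scalar m -> forall v w, m (v + w) = m v + m w.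
Proof. by move=> ml v w; have := ml 1 v w; rewrite scale1r mul1r. Qed.

Lemma scalar0 (m : W -> K) : scalar m -> m 0 = 0.
Proof. by move=> ml; apply: (addrI (m 0)); rewrite -scalarD// !addr0. Qed.

Lemma scalarZ (m : W -> K) : scalar m -> forall c v, m (c *: v) = c * m v.
Proof. by move=> ml c v; have := ml c v 0; rewrite !addr0 scalar0// addr0. Qed.

Lemma scalarB (m : W -> K) : scalar m -> forall v w, m (v - w) = m v - m w.
Proof. by move=> ml v w; rewrite -scaleN1r scalarD// scalarZ// mulN1r. Qed.

Lemma weak_open_finite (U : set W) x :
  open (U : set (weak_space nrm)) -> U x ->
  exists (ms : seq (W -> K)) (e : R),
    [/\ forall m, m \in ms -> dual_ball nrm m, 0 < e &
        forall y, (forall m, m \in ms -> absv (m x - m y) < e) -> U y].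
Proof.
move=> oU Ux.
(* Finite intersections of slabs generate a filter that converges to [x] in
   each of the initial topologies, hence in their supremum. *)
pose F : set_system W := [set A | exists (ms : seq (W -> K)) (e : R),
    [/\ forall m, m \in ms -> dual_ball nrm m, 0 < e &
        forall y, (forall m, m \in ms -> absv (m x - m y) < e) -> A y]].
have FF : Filter F.
  split.
  - by exists [::], 1.
  - move=> A B [ms [e [dms e0 mA]]] [ns [d [dns d0 nB]]].
    exists (ms ++ ns), (Num.min e d); split.
    + by move=> m; rewrite mem_cat => /orP[/dms|/dns].
    + by rewrite lt_min e0.
    + move=> y hy; split; [apply: mA|apply: nB] => m mm.
        have /hy : m \in ms ++ ns by rewrite mem_cat mm.
        by rewrite lt_min => /andP[].
      have /hy : m \in ms ++ ns by rewrite mem_cat mm orbT.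
      by rewrite lt_min => /andP[].
  - move=> A B AB [ms [e [dms e0 mA]]]; exists ms, e; split=> // y hy.
    exact/AB/mA.
suff Fx : F --> (x : weak_space nrm) by apply: Fx; exact: open_nbhs_nbhs.
apply/cvg_sup => -[m dm] A; rewrite nbhsE => -[B [[C oC <-] Cx] CA].
have [e e0 eC] := oC _ Cx.
exists [:: m], e; split => // [n|y]; first by rewrite inE => /eqP ->.
by move=> /(_ m (mem_head _ _)) hy; exact/CA/eC.
Qed.

Lemma weakly_closed_bigI (J : Type) (D : set J) (A : J -> set W) :
  (forall j, D j -> weakly_closed nrm (A j)) ->
  weakly_closed nrm (\bigcap_(j in D) A j).
Proof. by move=> cA; apply: closed_bigI. Qed.

Lemma weakly_closed_ker (m : W -> K) : dual_ball nrm m ->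
  weakly_closed nrm [set v | m v = 0].
Proof.
move=> dm.
have cm : continuous (m : weak_space nrm -> norm_space (absv : K -> R)).
  move=> x; have /cvg_sup/(_ (exist _ m dm)) := @cvg_id _ (nbhs (x : weak_space nrm)).
  by move=> cx; apply: cvg_trans (@initial_continuous _ _ _ x); exact: cvg_app.
have c0 : closed [set y : norm_space (absv : K -> R) | y = 0].
  rewrite -openC; suff : norm_open (absv : K -> R) [set y | y <> 0] by [].
  move=> y /= /eqP y0; exists (absv (y : K)); first exact: absv_gt0.
  by move=> z /= yz z0; move: yz; rewrite z0 subr0 ltxx.
exact: (iffLR (continuous_closedP _) cm _ c0).
Qed.

(** Only finitely many functionals are involved, so this is linear algebra and
    holds although the Hahn-Banach theorem fails over [K]: the first functional
    either vanishes on [A] or splits off a line from it. *)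
Lemma separation_finite (ms : seq (W -> K)) (A : set W) x e :
  (forall m, m \in ms -> dual_ball nrm m) -> 0 < e -> submod_closed (mem A) ->
  (forall y, A y -> ~ (forall m, m \in ms -> absv (m x - m y) < e)) ->
  exists m, [/\ bounded_scalar m, forall y, A y -> m y = 0 & m x <> 0].
Proof.
elim: ms A x => [|m ms IH] A x dms e0 /submod_closed_setP[A0 Alin] hA.
  by case: (hA 0).
have AD u v : A u -> A v -> A (u + v).
  by move=> Au Av; rewrite -[u]scale1r; exact: Alin.
have AZ a u : A u -> A (a *: u) by move=> Au; rewrite -[_ *: _]addr0; exact: Alin.
have dm : dual_ball nrm m by apply: dms; rewrite mem_head.
have dms' n : n \in ms -> dual_ball nrm n by move=> nms; apply: dms; rewrite inE nms orbT.
have [ml mb] := dm.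
have [Aker|] := pselect (forall y, A y -> m y = 0).
  have [mx|mx] := pselect (m x = 0).
    apply: IH => // [|y Ay hy]; first exact/submod_closed_setP.
    apply: (hA y Ay) => n; rewrite inE => /predU1P[->|].
      by rewrite mx Aker// subrr absv0.
    exact: hy.
  exists m; split => //; split => //; exists 1 => // v; first by rewrite mul1r.
move=> /existsNP[a0 /not_implyP[Aa0 /eqP ma0]].
(* Projecting along [a] reduces to the subspace where [m] vanishes. *)
pose a := (m a0)^-1 *: a0.
have Aa : A a by exact: AZ.
have ma : m a = 1 by rewrite (scalarZ ml) mulVf.
have [||n [[nl [C C0 nb]] nA nx]] := IH (A `&` [set y | m y = 0]) (x - m x *: a) dms' e0.
- apply/submod_closed_setP; split => [|b u v]; first by rewrite /= scalar0.
  move=> [Au mu0] [Av mv0]; split; first exact: Alin.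
  by rewrite /= (scalarD ml) (scalarZ ml) mu0 mv0 mulr0 addr0.
- move=> y [Ay my] hy; apply: (hA (y + m x *: a)); first by apply: AD => //; exact: AZ.
  move=> n; rewrite inE => /predU1P[->|nms].
    by rewrite (scalarD ml) (scalarZ ml) my ma mulr1 add0r subrr absv0.
  have [nl _] := dms' n nms; move: (hy n nms).
  by rewrite (scalarB nl) [n (y + _)](scalarD nl) opprD addrA [_ - n y]addrAC.
exists (fun v => n v - n a * m v); split.
- split; first by move=> b u v; rewrite nl ml; ring.
  exists (Num.max C (absv (n a))); first by rewrite le_max C0.
  move=> v; apply: absvB_le.
    by rewrite (le_trans (nb v))// ler_wpM2r// le_max lexx.
  by rewrite absvM ler_pM ?absv_ge0// le_max lexx orbT.
- move=> y Ay; have : n (y - m y *: a) = 0.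
    apply: nA; split; first by rewrite -scaleNr addrC; exact: Alin.
    by rewrite /= (scalarB ml) (scalarZ ml) ma mulr1 subrr.
  by rewrite (scalarB nl) (scalarZ nl) mulrC.
- by move: nx; rewrite (scalarB nl) (scalarZ nl) mulrC.
Qed.

Lemma separation (A : set W) x : submod_closed (mem A) -> weakly_closed nrm A ->
  ~ A x -> exists m, [/\ bounded_scalar m, forall y, A y -> m y = 0 & m x <> 0].
Proof.
move=> Asub /closed_openC oA Ax.
have [ms [e [dms e0 hms]]] := weak_open_finite oA Ax.
by apply: (separation_finite dms e0 Asub) => y Ay /hms; exact.
Qed.

End WeakClosedness.

(** * Scalars of prescribed size *)

Section ValuationScale.
Variables (R : realType) (K : valuationFieldType R).

Lemma expr_lt_small (p e : R) : 0 < p -> p < 1 -> 0 < e -> exists n, p ^+ n <= e.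
Proof.
move=> p0 p1 e0; have [d d0 pd] : exists2 d, 0 < d & p^-1 = 1 + d.
  by exists (p^-1 - 1); [rewrite subr_gt0 invf_gt1|rewrite addrC subrK].
have bern n : 1 + n%:R * d <= p^-1 ^+ n.
  elim: n => [|n IH]; first by rewrite mul0r addr0 expr0.
  rewrite exprS (le_trans _ (ler_wpM2l _ IH)) ?invr_ge0 ?(ltW p0)//.
  rewrite pd -natr1; have n0 : 0 <= n%:R * (d * d) by rewrite !mulr_ge0// ltW.
  by lra.
pose n := Num.bound (e^-1 / d); exists n.
have : e^-1 / d < n%:R by apply: archi_boundP; rewrite divr_ge0 ?invr_ge0 ?(ltW e0) ?(ltW d0).
rewrite ltr_pdivrMr// => h.
have : e^-1 <= (p ^+ n)^-1.
  by rewrite -exprVn (le_trans _ (bern n))// (le_trans (ltW h))// lerDr.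
by rewrite lef_pV2 ?posrE ?exprn_gt0.
Qed.

Lemma absvX (x : K) n : absv (x ^+ n) = absv x ^+ n.
Proof. by elim: n => [|n IH]; rewrite ?expr0 ?absv1// !exprS absvM IH. Qed.

Hypothesis hK : nontrivial_valuation K.

Lemma exists_absv_lt1 : exists2 p : K, p != 0 & absv p < 1.
Proof.
have [c [c0 c1]] := hK; have [h|h] := ltP (absv c) 1; first by exists c.
exists c^-1; first by rewrite invr_eq0.
by rewrite absvV invf_lt1 ?absv_gt0// lt_neqAle eq_sym c1.
Qed.

(** The constant [C] absorbs the gap between consecutive values of [absv]. *)
Lemma exists_scale : exists2 C : R, 0 < C & forall M, 0 < M ->
  exists c : K, [/\ c != 0, absv c * M <= 1 & (absv c)^-1 <= C * M].
Proof.
have [p p0 p1] := exists_absv_lt1; have ap0 := absv_gt0 p0.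
exists (absv p)^-1; first by rewrite invr_gt0.
move=> M M0.
have [k hk] := expr_lt_small ap0 p1 M0.
have pk0 : 0 < absv p ^+ k by rewrite exprn_gt0.
have y0 : 0 < absv p ^+ k / M by rewrite divr_gt0.
have y1 : absv p ^+ k / M <= 1 by rewrite ler_pdivrMr// mul1r.
have ex : exists n, absv p ^+ n <= absv p ^+ k / M by exact: expr_lt_small.
pose n := ex_minn ex.
have hn : absv p ^+ n <= absv p ^+ k / M by rewrite /n; case: ex_minnP.
have hn' : absv p ^+ k / M * absv p <= absv p ^+ n.
  rewrite /n; case: ex_minnP => -[|m] _ min.
    by rewrite expr0 mulr_ile1// ltW.
  rewrite exprSr ler_pM2r// leNgt; apply/negP => /ltW/min.
  by rewrite ltnn.
exists (p ^+ n / p ^+ k); split.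
- by rewrite mulf_neq0 ?invr_eq0 ?expf_neq0.
- by rewrite absvM absvV !absvX mulrAC ler_pdivrMr// mul1r -ler_pdivlMr.
- rewrite absvM absvV !absvX invfM invrK ler_pdivrMl ?exprn_gt0//.
  by rewrite mulrCA ler_pdivlMl// [_ * _ ^+ k]mulrC -ler_pdivrMr// mulrAC.
Qed.

Lemma exists_large (e : R) : 0 < e -> exists2 c : K, c != 0 & (absv c)^-1 < e.
Proof.
move=> e0; have [C C0 hC] := exists_scale.
have [|c [c0 _ hc]] := hC (e / C / 2); first by rewrite !divr_gt0.
exists c => //; rewrite (le_lt_trans hc)// mulrCA mulrA divfK ?gt_eqF//.
by rewrite ltr_pdivrMr// ltr_pMr// ltr1n.
Qed.

End ValuationScale.

(** * The scalar extension of the unit ball of the dual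

    [M] is any model of the unit ball of the dual of [V]: the identification [ev]
    keeps the scalar action on [M] apart from how the dual is built.  The scalar
    extension is then the space of all bounded functionals on [V], and [gauge] a
    norm equivalent to the operator norm. *)

Section GaugeDual.
Variables (R : realType) (K : valuationFieldType R) (V : banachType K).
Variables (M : lmodType (valring K)) (ev : M -> dual V).
Hypothesis hK : nontrivial_valuation K.
Hypotheses (evD : forall m n v, ev (m + n) v = ev m v + ev n v)
  (evZ : forall c m v, ev (c *: m) v = val c * ev m v)
  (ev_inj : injective ev) (ev_surj : forall d, exists m, ev m = d).

Lemma ev0 v : ev 0 v = 0.
Proof. by apply: (addrI (ev 0 v)); rewrite -evD !addr0. Qed.

Lemma ev_eq m n : (forall v, ev m v = ev n v) -> m = n.
Proof. by move=> mn; apply/ev_inj/dual_ext. Qed.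

Definition tensor_ev (v : V) : tensor M -> K := tensor_eval (fun c m => c * ev m v).

Lemma ev_balanced v : balanced (fun (c : K) m => c * ev m v).
Proof.
split=> [c d m|c m n|c a m]; first exact: mulrDl.
  by rewrite evD mulrDr.
by rewrite evZ mulrA.
Qed.

Lemma tensor_ev_scalar v : scalar (tensor_ev v).
Proof.
move=> a w x; rewrite /tensor_ev -[a *: w + x]/(tensor_add (tensor_scale a w) x).
rewrite tensor_evalD ?tensor_evalZ; try exact: ev_balanced.
congr (_ + _); rewrite /tensor_eval mulr_sumr.
by apply: eq_bigr => p _; rewrite mulrA.
Qed.

Lemma tensor_ev_pure v c m : tensor_ev v (pure_tensor c m) = c * ev m v.
Proof. by rewrite /tensor_ev tensor_eval_sum ?big_seq1//; exact: ev_balanced. Qed.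

Lemma pure_tensorDr c (m n : M) :
  pure_tensor c (m + n) = pure_tensor c m + pure_tensor c n.
Proof. by case: (pure_tensor_balanced M). Qed.

Lemma pure_tensor_slide c (a : valring K) (m : M) :
  pure_tensor (c * val a) m = pure_tensor c (a *: m).
Proof. by case: (pure_tensor_balanced M). Qed.

Lemma pure_tensor0 c : pure_tensor c (0 : M) = 0.
Proof. by apply: (addrI (pure_tensor c 0)); rewrite -pure_tensorDr !addr0. Qed.

(** Two fractions have a common denominator: of two scalars, one divides the
    other in the valuation ring. *)
Lemma tensor_sub_pure (L : set M) w : submod_closed (mem L) -> tensor_sub L w ->
  exists c l, [/\ c != 0, L l & w = pure_tensor c l].
Proof.
move=> /submod_closed_setP[L0 Llin] [s sL ->].
elim: s sL => [|[d n] s IH] sL.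
  by exists 1, 0; rewrite oner_neq0 big_nil pure_tensor0.
rewrite big_cons /=.
have [|c [m [c0 Lm ->]]] := IH; first by move=> p ps; apply: sL; rewrite inE ps orbT.
have Ln : L n by apply: (sL (d, n)); rewrite mem_head.
have [dc|cd] := leP (absv d) (absv c).
  have a1 : d / c \in @valring_pred R K.
    by rewrite inE absvM absvV ler_pdivrMr ?absv_gt0// mul1r.
  exists c, (Valring a1 *: n + m); split => //; first exact: Llin.
  by rewrite pure_tensorDr -pure_tensor_slide /= mulrCA divff// mulr1.
have d0 : d != 0.
  by apply/eqP => d0; move: cd; rewrite d0 absv0 ltNge absv_ge0.
have a1 : c / d \in @valring_pred R K.
  by rewrite inE absvM absvV ler_pdivrMr ?absv_gt0// mul1r ltW.
exists d, (Valring a1 *: m + n); split => //; first exact: Llin.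
by rewrite pure_tensorDr -pure_tensor_slide /= mulrCA divff// mulr1 addrC.
Qed.

Lemma tensor_pure (w : tensor M) : exists c m, c != 0 /\ w = pure_tensor c m.
Proof.
have [s ->] := tensor_repr w.
have [||c [m [c0 _ E]]] := @tensor_sub_pure setT (sum_tensor s); last by exists c, m.
  exact/submod_closed_setP.
exists s => //; elim: s => [|p s IH]; first by rewrite big_nil.
rewrite big_cons -IH -[RHS]/(tensor_add _ _).
apply: tensorP => A b bb; rewrite tensor_evalD// !tensor_eval_sum// big_cons.
by rewrite big_seq1.
Qed.

Lemma tensor_ev_inj w x : (forall v, tensor_ev v w = tensor_ev v x) -> w = x.
Proof.
move=> wx; apply/eqP; rewrite -subr_eq0; apply/eqP.
have {wx} : forall v, tensor_ev v (w - x) = 0.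
  by move=> v; rewrite (scalarB (tensor_ev_scalar v)) wx subrr.
have [c [m [c0 ->]]] := tensor_pure (w - x) => cm.
rewrite (_ : m = 0) ?pure_tensor0//; apply: ev_eq => v; rewrite ev0.
by have /eqP := cm v; rewrite tensor_ev_pure mulf_eq0 (negPf c0) => /eqP.
Qed.

Lemma scale_pure_tensor c (w : tensor M) m :
  c *: w = pure_tensor 1 m <-> forall v, c * tensor_ev v w = ev m v.
Proof.
split=> [cw v|cw]; first by rewrite -(scalarZ (tensor_ev_scalar v)) cw tensor_ev_pure mul1r.
by apply: tensor_ev_inj => v; rewrite (scalarZ (tensor_ev_scalar v)) cw tensor_ev_pure mul1r.
Qed.

Lemma tensor_ev_bounded c (w : tensor M) :
  (exists m, c *: w = pure_tensor 1 m) <->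
  forall v, absv (c * tensor_ev v w) <= bnorm v.
Proof.
split=> [[m /scale_pure_tensor cw] v|cw]; first by rewrite cw dual_le.
have wP : (fun v => c * tensor_ev v w) \in @dual_pred R K V.
  apply/dual_predP; split=> // a u v.
  have [d [m [_ ->]]] := tensor_pure w.
  by rewrite !tensor_ev_pure dualD dualZ; ring.
have [m em] := ev_surj (Dual wP); exists m; apply/scale_pure_tensor => v.
by rewrite em.
Qed.

Lemma gauge_has_inf (w : tensor M) : has_inf [set (absv c)^-1 | c in
  [set c : K | c != 0 /\ exists m : M, c *: w = pure_tensor 1 m]].
Proof.
split; last by exists 0 => _ [c _ <-]; rewrite invr_ge0 absv_ge0.
have [c [m [c0 ->]]] := tensor_pure w; exists (absv c^-1)^-1, c^-1 => //.
by split; [rewrite invr_eq0|exists m; rewrite pure_tensorZ mulVf].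
Qed.

Lemma gauge_le (w : tensor M) c : c != 0 ->
  (forall v, absv (c * tensor_ev v w) <= bnorm v) -> gauge w <= (absv c)^-1.
Proof.
move=> c0 cw; apply: ge_inf; first by case: (gauge_has_inf w).
by exists c => //; split=> //; exact/tensor_ev_bounded.
Qed.

Lemma gauge_lt (w : tensor M) e : gauge w < e -> exists c, [/\ c != 0,
  (absv c)^-1 < e & forall v, absv (c * tensor_ev v w) <= bnorm v].
Proof.
move=> we; have := gauge_has_inf w.
move=> /(@inf_adherent R _ (e - gauge w))[|_ [c [c0 /tensor_ev_bounded cw] <-]].
  by rewrite subr_gt0.
by rewrite -/(gauge w) subrKC => ce; exists c.
Qed.

Lemma gauge_ge0 (w : tensor M) : 0 <= gauge w.
Proof.
apply: lb_le_inf; first by case: (gauge_has_inf w).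
by move=> _ [c _ <-]; rewrite invr_ge0 absv_ge0.
Qed.

Lemma bnorm_ge0 (v : V) : 0 <= bnorm v.
Proof. by have [+ _ _ _] := bnormP (s := V); apply. Qed.

Lemma tensor_ev_gauge v (w : tensor M) : absv (tensor_ev v w) <= gauge w * bnorm v.
Proof.
apply/ler_addgt0Pl => e e0.
pose d := e / (bnorm v + 1).
have b1 : 0 < bnorm v + 1 by rewrite ltr_wpDl ?bnorm_ge0.
have [|c [c0 ce cw]] := @gauge_lt w (gauge w + d).
  by rewrite ltrDl divr_gt0.
have ac0 := absv_gt0 c0.
have := cw v; rewrite absvM -ler_pdivlMl// => h; apply: (le_trans h).
rewrite (le_trans (ler_wpM2r (bnorm_ge0 v) (ltW ce)))// mulrDl addrC lerD2r.
rewrite /d mulrAC ler_pdivrMr// ler_pM2l// lerDl ler01 //.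
Qed.

Lemma tensor_ev_dual_ball v : bnorm v <= 1 ->
  dual_ball (@gauge R K M) (tensor_ev v).
Proof.
move=> v1; split; first exact: tensor_ev_scalar.
by move=> w; rewrite (le_trans (tensor_ev_gauge v w))// ler_piMr// gauge_ge0.
Qed.

Lemma gauge_ultranorm : ultranorm (@gauge R K M).
Proof.
have Zle a (w : tensor M) : a != 0 -> gauge (a *: w) <= absv a * gauge w.
  move=> a0; have aa0 := absv_gt0 a0; apply/ler_addgt0Pl => e e0.
  have [|c [c0 ce cw]] := @gauge_lt w (gauge w + e / absv a).
    by rewrite ltrDl divr_gt0.
  apply: (@le_trans _ _ (absv (c / a))^-1).
    apply: gauge_le; first by rewrite mulf_neq0 ?invr_eq0.
    by move=> v; rewrite (scalarZ (tensor_ev_scalar v)) mulrA divfK.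
  rewrite absvM absvV invfM invrK mulrC.
  rewrite (le_trans (ler_wpM2l (ltW aa0) (ltW ce)))// mulrDr addrC.
  by rewrite mulrCA divff ?gt_eqF// mulr1.
split.
- exact: gauge_ge0.
- move=> w w0; apply: tensor_ev_inj => v.
  rewrite (scalar0 (tensor_ev_scalar v)); apply/absv_eq0/le_anti.
  by rewrite absv_ge0 andbT (le_trans (tensor_ev_gauge v w))// w0 mul0r.
- move=> a w; have [->|a0] := eqVneq a 0.
    rewrite scale0r absv0 mul0r; apply/le_anti; rewrite gauge_ge0 andbT.
    apply/ler_addgt0Pl => e e0; have [c c0 ce] := exists_large hK e0.
    rewrite addr0 (le_trans _ (ltW ce))//; apply: gauge_le => // v.
    by rewrite (scalar0 (tensor_ev_scalar v)) mulr0 absv0 bnorm_ge0.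
  apply/le_anti; rewrite Zle//=.
  rewrite -ler_pdivlMl ?absv_gt0// -absvV.
  by rewrite (le_trans _ (Zle _ _ _)) ?invr_eq0// scalerA mulVf// scale1r.
- move=> w x; apply/ler_addgt0Pl => e e0.
  pose m := Num.max (gauge w) (gauge x).
  have [|c [c0 ce cw]] := @gauge_lt w (m + e).
    by rewrite ltr_pwDr// le_max lexx.
  have [|d [d0 de dx]] := @gauge_lt x (m + e).
    by rewrite ltr_pwDr// le_max lexx orbT.
  have [a [a0 ae aw ax]] : exists a, [/\ a != 0, (absv a)^-1 < m + e,
      forall v, absv (a * tensor_ev v w) <= bnorm v &
      forall v, absv (a * tensor_ev v x) <= bnorm v].
    have mono a b y : absv a <= absv b ->
        (forall v, absv (b * tensor_ev v y) <= bnorm v) ->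
        forall v, absv (a * tensor_ev v y) <= bnorm v.
      move=> ab hb v; apply: le_trans (hb v).
      by rewrite !absvM ler_wpM2r ?absv_ge0.
    have [cd|/ltW dc] := leP (absv c) (absv d).
      by exists c; split=> //; exact: mono cd dx.
    by exists d; split=> //; exact: mono dc cw.
  rewrite -/m [e + m]addrC (le_trans _ (ltW ae))//; apply: gauge_le => // v.
  by rewrite (scalarD (tensor_ev_scalar v)) mulrDr; exact: absvD_le.
Qed.

(** A Cauchy sequence converges pointwise.  Choosing one scalar [c] with
    [(absv c)^-1 < e] beforehand, all late differences multiplied by [c] lie in
    the unit ball of the dual, which is stable under pointwise limits. *)
Lemma gauge_complete : complete_norm (@gauge R K M).
Proof.
move=> u uC.
have close e : 0 < e -> exists c, [/\ c != 0, (absv c)^-1 < e & exists N,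
    forall i j, (N <= i)%N -> (N <= j)%N ->
    forall v, absv (c * tensor_ev v (u i - u j)) <= bnorm v].
  move=> e0; have [c c0 ce] := exists_large hK e0; exists c; split=> //.
  have [|N hN] := uC (absv c)^-1; first by rewrite invr_gt0 absv_gt0.
  exists N => i j Ni Nj v.
  rewrite absvM -ler_pdivlMl ?absv_gt0// (le_trans (tensor_ev_gauge _ _))//.
  by rewrite ler_wpM2r ?bnorm_ge0// ltW// hN.
have /choice[l hl] : forall v, exists l, forall e, 0 < e ->
    exists N, forall i, (N <= i)%N -> absv (tensor_ev v (u i) - l) < e.
  move=> v; apply: absv_complete => e e0.
  have [|c [c0 ce [N hN]]] := close (e / (bnorm v + 1)).
    by rewrite divr_gt0// ltr_wpDl ?bnorm_ge0.
  exists N => i j Ni Nj; rewrite -(scalarB (tensor_ev_scalar v)).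
  have := hN i j Ni Nj v; rewrite absvM -ler_pdivlMl ?absv_gt0// => h.
  rewrite (le_lt_trans h)//.
  have b1 : 0 < bnorm v + 1 by rewrite ltr_wpDl ?bnorm_ge0.
  rewrite ltr_pdivlMr// in ce; apply: le_lt_trans ce.
  by rewrite ler_pM2l ?invr_gt0 ?absv_gt0// lerDl ler01.
have limit c N : c != 0 -> (forall i j, (N <= i)%N -> (N <= j)%N ->
      forall v, absv (c * tensor_ev v (u i - u j)) <= bnorm v) ->
    forall i, (N <= i)%N -> forall v, absv (c * (tensor_ev v (u i) - l v)) <= bnorm v.
  move=> c0 hN i Ni v; apply/ler_addgt0Pl => e e0.
  have [|N' hN'] := hl v (e / absv c); first by rewrite divr_gt0 ?absv_gt0.
  pose j := maxn N N'.
  have -> : c * (tensor_ev v (u i) - l v) =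
      c * tensor_ev v (u i - u j) + c * (tensor_ev v (u j) - l v).
    by rewrite (scalarB (tensor_ev_scalar v)); ring.
  apply: absvD_le.
    rewrite (le_trans (hN i j Ni _ v)) ?leq_maxl// lerDr ltW//.
  rewrite absvM -ler_pdivlMl ?absv_gt0// ltW// (lt_le_trans (hN' j (leq_maxr _ _)))//.
  by rewrite mulrC ler_pM2l ?invr_gt0 ?absv_gt0// lerDl bnorm_ge0.
have [w hw] : exists w : tensor M, forall v, tensor_ev v w = l v.
  have [c [c0 _ [N hN]]] := close 1 ltr01.
  have dP : (fun v => c * (tensor_ev v (u N) - l v)) \in @dual_pred R K V.
    apply/dual_predP; split; last by move=> v; exact: (limit c N).
    move=> a v1 v2.
    have lin w : tensor_ev (a *: v1 + v2) w = a * tensor_ev v1 w + tensor_ev v2 w.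
      have [d [m [_ ->]]] := tensor_pure w.
      by rewrite !tensor_ev_pure dualD dualZ; ring.
    rewrite lin (_ : l _ = a * l v1 + l v2); first by ring.
    apply/eqP; rewrite -subr_eq0; apply/eqP/eq0_absv_le => e e0.
    have m0 : 0 < Num.max (absv a) 1 by rewrite lt_max ltr01 orbT.
    have [|N1 hN1] := hl v1 (e / Num.max (absv a) 1); first by rewrite divr_gt0.
    have [N2 hN2] := hl v2 e e0; have [N3 hN3] := hl (a *: v1 + v2) e e0.
    pose i := maxn N1 (maxn N2 N3).
    have -> : l (a *: v1 + v2) - (a * l v1 + l v2) = a * (tensor_ev v1 (u i) - l v1)
        + (tensor_ev v2 (u i) - l v2) - (tensor_ev (a *: v1 + v2) (u i) - l (a *: v1 + v2)).
      by rewrite lin; ring.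
    apply: absvB_le; last by rewrite ltW// hN3// /i !leq_max leqnn !orbT.
    apply: absvD_le; last by rewrite ltW// hN2// /i !leq_max leqnn !orbT.
    have := hN1 i (leq_maxl _ _); rewrite ltr_pdivlMr// mulrC absvM => h.
    by rewrite (le_trans _ (ltW h))// ler_wpM2r ?absv_ge0// le_max lexx.
  have [m em] := ev_surj (Dual dP); exists (u N - pure_tensor c^-1 m) => v.
  rewrite (scalarB (tensor_ev_scalar v)) tensor_ev_pure em /=.
  by rewrite mulrA mulVf// mul1r subKr.
exists w => e e0; have [c [c0 ce [N hN]]] := close e e0.
exists N => i Ni; rewrite (le_lt_trans _ ce)//; apply: gauge_le => // v.
by rewrite (scalarB (tensor_ev_scalar v)) hw; exact: (limit c N).
Qed.

Lemma gauge_generically_complete : generically_complete M.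
Proof.
split; [|exact: gauge_ultranorm|exact: gauge_complete].
move=> c m c0 cm; apply: ev_eq => v; rewrite ev0.
have : val c * ev m v = 0 by rewrite -evZ cm ev0.
by move/eqP; rewrite mulf_eq0 => /orP[/eqP vc|/eqP//]; case/eqP: c0; exact: val_inj.
Qed.

End GaugeDual.

(** * Reflexivity of free Banach spaces *)

Section Coordinates.
Variables (R : realType) (K : valuationFieldType R) (V : banachType K).
Variables (I : choiceType) (phi : V -> (I -> K^o)).
Hypotheses (phi_linear : linear phi) (phi_bij : set_bij setT (@C0 R K I) phi)
  (phi_norm : forall v, supnorm (phi v : I -> K) = bnorm v).

Lemma coord_linear a u v i : phi (a *: u + v) i = a * phi u i + phi v i.
Proof. by rewrite phi_linear. Qed.

Lemma coord_C0 v : C0 (phi v).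
Proof. by have [h _ _] := phi_bij; exact: h. Qed.

Lemma coord_inj u v : phi u =1 phi v -> u = v.
Proof. by have [_ h _] := phi_bij => uv; apply: h; [exact: mem_set|exact: mem_set|exact: funext]. Qed.

Lemma coord_surj (u : I -> K^o) : C0 u -> exists v, phi v = u.
Proof. by have [_ _ h] := phi_bij => /h[v _]; exists v. Qed.

Lemma coord_le v i : absv (phi v i : K) <= bnorm v.
Proof.
rewrite -phi_norm; apply: ub_le_sup; last by exists i.
have [M _ vM] := C0_bounded (coord_C0 v).
by exists M => _ [j _ <-]; exact: vM.
Qed.

Lemma bnorm_le v e : 0 <= e -> bounded_by (phi v : I -> K) e -> bnorm v <= e.
Proof.
move=> e0 ve; rewrite -phi_norm /supnorm.
have [[i _]|I0] := pselect (exists i : I, True).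
  apply: ge_sup; first by exists (absv (phi v i : K)), i.
  by move=> _ [j _ <-]; exact: ve.
have -> : range (fun i => absv (phi v i : K)) = set0; last by rewrite sup0.
by apply/seteqP; split=> // x [j _ _]; apply: I0; exists j.
Qed.

Definition pairing (f : I -> K) (v : V) : K := csum (fun i => f i * phi v i).

Lemma pairing_scalar f M : bounded_by f M -> scalar (pairing f).
Proof.
move=> fM a u v; rewrite /pairing -csumD; try exact: C0M fM (coord_C0 _).
by congr csum; apply/funext => i; rewrite coord_linear; ring.
Qed.

Lemma pairing_le f v : bounded_by f 1 -> absv (pairing f v) <= bnorm v.
Proof.
move=> f1; have v0 := bnorm_ge0 v.
apply: csum_le => //; first exact: C0M f1 (coord_C0 v).
by move=> i; rewrite absvM -[leRHS]mul1r ler_pM ?absv_ge0 ?coord_le.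
Qed.

Lemma exists_dual f : bounded_by f 1 -> exists d : dual V, forall v, d v = pairing f v.
Proof.
move=> f1; have dP : pairing f \in @dual_pred R K V.
  by apply/dual_predP; split; [exact: pairing_scalar f1|move=> v; exact: pairing_le].
by exists (Dual dP).
Qed.

Lemma dual_pairing (d : dual V) :
  exists2 f, bounded_by f 1 & forall v, d v = pairing f v.
Proof.
have unit0 i : C0 (unit_fun K i : I -> K^o).
  apply: C0_finite; apply: sub_finite_set (finite_set1 i) => j /=.
  by rewrite /unit_fun; case: eqP.
have /choice[e he] := fun i => coord_surj (unit0 i).
pose f i := d (e i); have f1 : bounded_by f 1.
  move=> i; rewrite (le_trans (dual_le _ _))//; apply: bnorm_le => //.
  by rewrite he; exact: bounded_by_unit.
exists f => // v.
(* The difference of both sides is continuous and kills the span of the [e i]. *)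
pose g v := d v - pairing f v.
have gs : scalar g.
  by move=> a u w; rewrite /g dualD dualZ (pairing_scalar f1); ring.
have ge i : g (e i) = 0.
  rewrite /g /pairing he (_ : (fun j => _) = fun j => f i * unit_fun K i j).
    by rewrite csum_unit subrr.
  by apply/funext => j; rewrite /unit_fun; case: eqP => [->//|_]; rewrite !mulr0.
have gfin (s : seq I) : forall w, (forall i, i \notin s -> phi w i = 0) -> g w = 0.
  elim: s => [|i s IH] w ws.
    rewrite (_ : w = 0) ?(scalar0 gs)//; apply: coord_inj => i; rewrite ws//.
    have := coord_linear (-1) 0 0 i.
    by rewrite scaler0 addr0 mulN1r addNr.
  have : g ((- phi w i) *: e i + w) = 0.
    apply: IH => j js; rewrite coord_linear he /unit_fun.
    have [->|ji] := eqVneq j i; first by rewrite mulr1 addNr.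
    by rewrite mulr0 add0r ws// inE negb_or ji.
  by rewrite (scalarD gs) (scalarZ gs) ge mulr0 add0r.
apply/eqP; rewrite -subr_eq0; apply/eqP/eq0_absv_le => r r0; rewrite -/(g v).
have fin := finitely_supported_truncate r0 (coord_C0 v).
have [w hw] := coord_surj (C0_finite fin).
have /finite_seqP[s hs] := fin.
have gw : g w = 0.
  apply: (gfin s) => i nis; rewrite hw; apply: contrapT => wi.
  by move/negP: nis; apply; have : [set` s] i by rewrite -hs.
rewrite -[g v]subr0 -gw -(scalarB gs).
have vw : bnorm (v - w) <= r.
  apply: bnorm_le; first exact: ltW.
  move=> i; rewrite -[v - w]addrC -scaleN1r coord_linear mulN1r addrC hw.
  by apply: truncate_near; exact: ltW.
by apply: (le_trans _ vw); apply: absvB_le; [exact: dual_le|exact: pairing_le].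
Qed.

Section Reflexivity.
Variables (M : lmodType (valring K)) (ev : M -> dual V).
Hypotheses (hK : nontrivial_valuation K) (nsph : non_spherically_complete K)
  (nmeas : non_measurable I).
Hypotheses (evD : forall m n v, ev (m + n) v = ev m v + ev n v)
  (evZ : forall c m v, ev (c *: m) v = val c * ev m v)
  (ev_inj : injective ev) (ev_surj : forall d, exists m, ev m = d).

(** Bounded functions are coordinates of bounded functionals on [V], so [psi]
    pulls back to a bounded functional on bounded functions; the family that
    represents it by [functional_csum] is the coordinate family of [v]. *)
Lemma reflexivity (psi : tensor M -> K) : bounded_scalar (@gauge R K M) psi ->
  exists v, forall m, psi (pure_tensor 1 m) = ev m v.
Proof.
move=> [ps [B B0 pb]].
have [C C0' hC] := exists_scale hK.
(* Scaling [f] into the unit ball by [c] yields an element of [M]; dividing by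
   [c] in the scalar extension undoes it. *)
have tensor_of f L : 0 < L -> bounded_by f L -> exists t : tensor M,
    (forall v, tensor_ev ev v t = pairing f v) /\ gauge t <= C * L.
  move=> L0 fL; have [c [c0 cL hc]] := hC L L0.
  have cf1 : bounded_by (fun i => c * f i) 1.
    by apply: bounded_byW (bounded_byZ c fL).
  have [d hd] := exists_dual cf1; have [m hm] := ev_surj d.
  have tE v : tensor_ev ev v (pure_tensor c^-1 m) = pairing f v.
    rewrite (tensor_ev_pure evD evZ) hm hd /pairing.
    rewrite (_ : (fun i => _) = fun i => c * (f i * phi v i)).
      by rewrite csumZ ?mulrA ?mulVf ?mul1r//; exact: C0M fL (coord_C0 _).
    by apply/funext => i; rewrite mulrA.
  exists (pure_tensor c^-1 m); split=> //; apply: le_trans hc.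
  apply: (gauge_le evD evZ ev_inj ev_surj) => // v.
  rewrite (tensor_ev_pure evD evZ) mulrA divff// mul1r; exact: dual_le.
have /choice[T hT] : forall f, exists t : tensor M,
    forall L, 0 < L -> bounded_by f L ->
    (forall v, tensor_ev ev v t = pairing f v) /\ gauge t <= C * L.
  move=> f; have [[L [L0 fL]]|no] := pselect (exists L, 0 < L /\ bounded_by f L).
    have [t [tE _]] := tensor_of f L L0 fL; exists t => L' L'0 fL'; split=> //.
    have [t' [t'E t'L]] := tensor_of f L' L'0 fL'.
    by rewrite (_ : t = t')//; apply: (tensor_ev_inj evD evZ ev_inj) => v; rewrite tE t'E.
  by exists 0 => L L0 fL; case: no; exists L.
have pos (f : I -> K) L : bounded_by f L -> 0 < `|L| + 1 /\ bounded_by f (`|L| + 1).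
  move=> fL; split; first by rewrite ltr_pwDr.
  by apply: bounded_byW fL; rewrite (le_trans (ler_norm _))// lerDl.
have PhiP : bounded_functional (fun f => psi (T f)).
  split=> [a f g L fL gL|].
    rewrite -ps; congr psi; apply: (tensor_ev_inj evD evZ ev_inj) => v.
    have [L1 fL1] := pos f L fL; have [_ gL1] := pos g L gL.
    have [L2 fgL2] := pos _ _ (bounded_byD a fL1 gL1).
    rewrite (tensor_ev_scalar evD evZ) (hT _ _ L1 fL1).1 (hT _ _ L1 gL1).1.
    rewrite (hT _ _ L2 fgL2).1 /pairing -csumD.
    - by congr csum; apply/funext => i; ring.
    - exact: C0M fL (coord_C0 _).
    - exact: C0M gL (coord_C0 _).
  exists (B * C + 1); first by rewrite ltr_pwDr// mulr_ge0// ltW.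
  move=> f L L0 fL; apply/ler_addgt0Pr => e e0.
  (* [tensor_of] needs a positive bound, whereas [L] may be 0. *)
  pose L' := L + e / (B * C + 1).
  have BC : 0 < B * C + 1 by rewrite ltr_pwDr// mulr_ge0// ltW.
  have L'0 : 0 < L' by rewrite ltr_pwDr// divr_gt0.
  have fL' : bounded_by f L' by apply: bounded_byW fL; rewrite lerDl ltW// divr_gt0.
  rewrite (le_trans (pb _))// (le_trans (ler_wpM2l B0 (hT f L' L'0 fL').2))//.
  rewrite (_ : (B * C + 1) * L + e = (B * C + 1) * L'); last first.
    by rewrite /L' mulrDr [_ * (e / _)]mulrC divfK// gt_eqF.
  by rewrite mulrA ler_wpM2r ?ltW// ltrDl.
have [u u0 hu] := functional_csum nsph nmeas PhiP.
have [v hv] := coord_surj u0; exists v => m.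
have [f f1 fE] := dual_pairing (ev m).
have -> : pure_tensor 1 m = T f.
  apply: (tensor_ev_inj evD evZ ev_inj) => w.
  by rewrite (hT f 1 ltr01 f1).1 (tensor_ev_pure evD evZ) mul1r fE.
by rewrite (hu f 1 f1) fE /pairing hv.
Qed.

End Reflexivity.
End Coordinates.

(** * Annihilators *)

Section Annihilators.
Variables (R : realType) (K : valuationFieldType R) (V : banachType K).
Variables (M : lmodType (valring K)) (ev : M -> dual V).
Hypothesis hK : nontrivial_valuation K.
Hypotheses (evD : forall m n v, ev (m + n) v = ev m v + ev n v)
  (evZ : forall c m v, ev (c *: m) v = val c * ev m v)
  (ev_inj : injective ev) (ev_surj : forall d, exists m, ev m = d).
Implicit Types (W : set V) (L : set M).

Definition annihilator W : set M := [set m | forall v, W v -> ev m v = 0].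

Definition coannihilator L : set V := [set v | forall m, L m -> ev m v = 0].

Lemma annihilator_submod W : submod_closed (mem (annihilator W)).
Proof.
apply/submod_closed_setP; split=> [v _|a m n mW nW v Wv]; first exact: ev0.
by rewrite evD evZ mW// nW// mulr0 addr0.
Qed.

Lemma coannihilator_submod L : submod_closed (mem (coannihilator L)).
Proof.
apply/submod_closed_setP; split=> [m _|a v w vL wL m Lm]; first exact: dual0.
by rewrite dualD dualZ vL// wL// mulr0 addr0.
Qed.

Lemma annihilator_pure W : pure_submodule (annihilator W).
Proof.
apply/seteqP; split=> [m [c [c0 cm]] v Wv|m mW].
  have /eqP := cm v Wv; rewrite evZ mulf_eq0 => /orP[/eqP vc|/eqP//].
  by case/eqP: c0; exact: val_inj.
by exists 1; rewrite oner_neq0 scale1r.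
Qed.

(** The scalar extension of the annihilator is cut out by the evaluations at the
    vectors of [W], which may be scaled into the unit ball. *)
Lemma annihilator_weakly_closed W : submod_closed (mem W) ->
  generically_weakly_closed (annihilator W).
Proof.
move=> /submod_closed_setP[W0 Wlin]; split.
  exact: (gauge_generically_complete hK evD evZ ev_inj ev_surj).
rewrite (_ : tensor_sub _ =
    \bigcap_(v in W `&` [set v | bnorm v <= 1]) [set w | tensor_ev ev v w = 0]).
  apply: weakly_closed_bigI => v [_ v1]; apply: weakly_closed_ker.
  exact: (tensor_ev_dual_ball evD evZ).
apply/seteqP; split=> [w /(tensor_sub_pure (annihilator_submod W))|w hw].
  move=> [c [l [_ lW ->]]] v [Wv _] /=.
  by rewrite (tensor_ev_pure evD evZ) lW// mulr0.
have [c [m [c0 wE]]] := tensor_pure w.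
exists [:: (c, m)]; last by rewrite big_seq1.
move=> p; rewrite inE => /eqP -> v Wv /=.
have [C _ hC] := exists_scale hK.
have [|d [d0 dv _]] := hC (bnorm v + 1); first by rewrite ltr_wpDl ?bnorm_ge0.
have Wdv : W (d *: v) by rewrite -[_ *: _]addr0; exact: Wlin.
have : tensor_ev ev (d *: v) w = 0.
  apply: hw; split=> //=; have [_ _ -> _] := bnormP (s := V).
  by rewrite (le_trans _ dv)// ler_wpM2l ?absv_ge0// lerDl.
rewrite wE (tensor_ev_pure evD evZ) dualZ => /eqP.
by rewrite !mulf_eq0 (negPf c0) (negPf d0) => /eqP.
Qed.

Lemma coannihilator_weakly_closed L :
  weakly_closed (bnorm : V -> R) (coannihilator L).
Proof.
rewrite (_ : coannihilator L = \bigcap_(m in L) [set v | ev m v = 0])//.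
apply: weakly_closed_bigI => m _; apply: weakly_closed_ker.
by split; [exact: dual_scalar|exact: dual_le].
Qed.

(** A functional given by [separation] can be scaled into the unit ball of the
    dual. *)
Lemma annihilatorK W : submod_closed (mem W) -> weakly_closed (bnorm : V -> R) W ->
  coannihilator (annihilator W) = W.
Proof.
move=> Wsub Wcl; apply/seteqP; split=> [v vW|v Wv m]; last exact.
apply: contrapT => nWv.
have [n [[ns [C C0 nb]] nW nv]] := separation (@bnorm_ge0 _ _ V) Wsub Wcl nWv.
have [D _ hD] := exists_scale hK.
have [|c [c0 cC _]] := hD (C + 1); first by rewrite ltr_wpDl.
have dP : (fun v => c * n v) \in @dual_pred R K V.
  apply/dual_predP; split=> [a u w|w]; first by rewrite ns; ring.
  rewrite absvM (le_trans (ler_wpM2l (absv_ge0 c) (nb w)))// mulrA.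
  rewrite ler_piMl ?bnorm_ge0// (le_trans _ cC)// ler_wpM2l ?absv_ge0//.
  by rewrite lerDl.
have [m mE] := ev_surj (Dual dP).
have /vW/eqP : annihilator W m by move=> w Ww; rewrite mE /= nW// mulr0.
by rewrite mE mulf_eq0 (negPf c0) => /eqP.
Qed.

(** Reflexivity turns a functional that separates [m] from [L] into a vector
    annihilated by [L]; purity is what descends membership from the scalar
    extension of [L] to [L]. *)
Lemma coannihilatorK L :
  (forall psi, bounded_scalar (@gauge R K M) psi ->
     exists v, forall m, psi (pure_tensor 1 m) = ev m v) ->
  submod_closed (mem L) -> generically_weakly_closed L -> pure_submodule L ->
  annihilator (coannihilator L) = L.
Proof.
move=> refl Lsub [_ Lcl] Lpure; apply/seteqP; split=> [m mL|m Lm v]; last exact.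
have [L0 Llin] := iffLR (submod_closed_setP L) Lsub.
apply: contrapT => nLm.
have Tsub : submod_closed (mem (tensor_sub L)).
  apply/submod_closed_setP; split; first by exists [::]; rewrite ?big_nil.
  move=> a w x [s sL ->] [t tL ->].
  exists ([seq (a * p.1, p.2) | p <- s] ++ t).
    by move=> p; rewrite mem_cat => /orP[/mapP[q qs ->]|/tL//]; exact: (sL q qs).
  rewrite big_cat big_map scaler_sumr; congr (_ + _).
  by apply: eq_bigr => p _; rewrite pure_tensorZ.
have nTm : ~ tensor_sub L (pure_tensor 1 m).
  move=> /(tensor_sub_pure Lsub)[c [l [c0 Ll E]]]; apply: nLm.
  have ml v : ev m v = c * ev l v.
    have := congr1 (tensor_ev ev v) E.
    by rewrite !(tensor_ev_pure evD evZ) mul1r.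
  (* Either [c] or its inverse is integral. *)
  have [c1|c1] := leP (absv c) 1.
    have cP : c \in @valring_pred R K by rewrite inE.
    rewrite (_ : m = Valring cP *: l + 0); first exact: Llin.
    by apply: (ev_eq ev_inj) => v; rewrite addr0 evZ ml.
  have cP : c^-1 \in @valring_pred R K by rewrite inE absvV invf_le1 ?absv_gt0// ltW.
  rewrite -Lpure; exists (Valring cP); split.
    by apply/eqP => /(congr1 val)/eqP; rewrite /= invr_eq0 (negPf c0).
  rewrite (_ : _ *: m = l)//; apply: (ev_eq ev_inj) => v.
  by rewrite evZ ml /= mulrA mulVf// mul1r.
have [psi [psib psiL psim]] :=
  separation (@gauge_ge0 _ _ M) Tsub Lcl nTm.
have [v hv] := refl psi psib.
apply: psim; rewrite hv; apply: mL => l Ll.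
rewrite -hv; apply: psiL; exists [:: (1, l)]; last by rewrite big_seq1.
by move=> p; rewrite inE => /eqP ->.
Qed.

End Annihilators.

Theorem theorem5p13 (R : realType) (K : valuationFieldType R)
    (hK : nontrivial_valuation K) (hsph : non_spherically_complete K)
    (G : profiniteGroupType)
    (hG : non_measurable {H : set G | open_normal_subgroup H})
    (r : unitary_rep G K) :
  weakly_irreducible r <-> generically_weakly_simple (rep_dual r).
Proof.
have [I [nmeas [phi [phi_linear phi_bij phi_norm]]]] := rep_free r.
pose V := rep_space r; pose M := restricted (rep_dual r).
pose ev (m : M) : dual V := m.
have evD (m n : M) v : ev (m + n) v = ev m v + ev n v by [].
have evZ c (m : M) v : ev (c *: m) v = val c * ev m v.
  exact: restricted_scaleE.
have ev_inj : injective ev by [].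
have ev_surj (d : dual V) : exists m, ev m = d by exists d.
have refl := @reflexivity R K V {classic I} phi phi_linear phi_bij phi_norm
  M ev hK hsph nmeas evD evZ ev_inj ev_surj.
suff bij : set_bij [set W | subrepresentation W /\ weakly_closed (bnorm : V -> R) W]
    [set L : set (rep_dual r) | [/\ submod_closed (mem L),
       @generically_weakly_closed R K M L & @pure_submodule R K M L]]
    (annihilator ev).
  have card := pcard_eq bij.
  by split=> h; [apply: card_eq_trans h; rewrite card_eq_sym|exact: card_eq_trans h].
split.
- move=> W [[Wsub Wstable] Wcl]; split.
  + apply/submod_closed_setP; split=> [v _|mu m n mW nW v Wv]; first exact: (ev0 evD).
    (* [mu] integrates the orbit function of [m] at [v], which is zero since the
       orbit of [v] stays in [W]. *)
    have -> : ev (mu *: m + n) v = mu (orbit_fun m v) + ev n v by [].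
    rewrite nW// addr0 (_ : orbit_fun m v = 0) ?dual0//.
    by apply/val_inj/funext => g; apply: mW; exact: Wstable.
  + exact: annihilator_weakly_closed.
  + exact: annihilator_pure.
- move=> W W' /set_mem[[Wsub _] Wcl] /set_mem[[W'sub _] W'cl] WW'.
  rewrite -(annihilatorK hK ev_surj Wsub Wcl) WW'.
  exact: (annihilatorK hK ev_surj W'sub W'cl).
- move=> L [Lsub Lcl Lpure].
  have [L0 Llin] := iffLR (submod_closed_setP L) Lsub.
  have LsubK : submod_closed (mem (L : set M)).
    by apply/submod_closed_setP; split=> // a u v; exact: Llin.
  exists (coannihilator ev L).
    split; last exact: coannihilator_weakly_closed.
    split; first exact: coannihilator_submod.
    move=> g v vL m Lm.
    (* Acting by the inverse of [g] on [m] is precomposing [m] with [g]. *)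
    have : ev (group_element K g^-1%g *: (m : rep_dual r)) v = 0.
      by apply: vL; rewrite -[_ *: _]addr0; exact: Llin.
    by rewrite /ev group_element_actE invgK.
  exact: (coannihilatorK evD evZ ev_inj refl).
Qed.
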